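(* Let $L$ be a countably infinite set and consider the edgeless cube $Q_L$. Every legal configuration accessible from $f_{\mathrm{solved}}$ can be solved in at most $\omega^2$ many moves: for each such configuration $f$ there is a basic sequence of length at most $\omega^2$ which, applied to $f$, has terminal configuration $f_{\mathrm{solved}}$.
   Context: Let $L$ be an infinite set, $-L=\{-r:r\in L\}$ a disjoint copy of $L$, and $0$ a new element; $L^\dagger=-L\cup\{0\}\cup L$ with $-(-r)=r$, $-0=0$. Adjoin $\pm\infty$ with $-(+\infty)=-\infty$ and set $\bar L^\dagger=L^\dagger\cup\{\pm\infty\}$. Points of $U=(\bar L^\dagger)^3$ have coordinates $x,y,z$. The edgeless cube $Q_L$ is the set of cells: points of $U$ with exactly one coordinate in $\{\pm\infty\}$. For $i\in\{x,y,z\}$, $\alpha\in\bar L^\dagger$, the quarter-turn twist $T_{i,\alpha}$ is the permutation of cells fixing every cell $p$ with $p_i\ne\alpha$ and acting on the others by $T_{x,\alpha}(\alpha,y,z)=(\alpha,-z,y)$, $T_{y,\alpha}(x,\alpha,z)=(z,\alpha,-x)$, $T_{z,\alpha}(x,y,\alpha)=(-y,x,\alpha)$ (so a face twist $T_{i,\pm\infty}$ moves only cells of that face). Basic twists are $T,T^2,T^3$ for quarter-turn twists $T$. A basic sequence is a sequence $\langle\sigma_\eta:\eta<\theta\rangle$ of basic twists of ordinal length $\theta$. A configuration is a map $f$ from cells to the six colors red, white, green, orange, yellow, blue together with a special value NaC; it is legal if it never takes value NaC. The solved configuration $f_{\mathrm{solved}}$ colors a cell red, blue, white, orange, green, yellow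 according as $x=+\infty$, $y=+\infty$, $z=+\infty$, $x=-\infty$, $y=-\infty$, $z=-\infty$. A twist $\sigma$ acts by $(\sigma f)(c)=f(\sigma^{-1}c)$. Applying $\langle\sigma_\eta:\eta<\theta\rangle$ to $f_0$ produces $f_{\eta+1}=\sigma_\eta f_\eta$, and for limit $\lambda\le\theta$, $f_\lambda(c)$ is the eventually constant value of $f_\eta(c)$ ($\eta<\lambda$) if it exists and NaC otherwise; $f_\theta$ is the terminal configuration. $f$ is accessible from $f_0$ if it is the terminal configuration of some basic sequence applied to $f_0$. *)

(* Defs.v *)
From Stdlib Require Import Arith Lia ClassicalEpsilon.

Set Implicit Arguments.

Definition dec (P : Prop) : {P} + {~ P} := excluded_middle_informative P.

Section Cube.
Variable L : Type.

Inductive Ldag : Type := Neg (r : L) | Zero | Pos (r : L).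
Inductive Lbar : Type := Fin (a : Ldag) | PInf | MInf.

Definition negdag (a : Ldag) : Ldag :=
  match a with Neg r => Pos r | Zero => Zero | Pos r => Neg r end.
Definition negbar (u : Lbar) : Lbar :=
  match u with Fin a => Fin (negdag a) | PInf => MInf | MInf => PInf end.

Definition point : Type := (Lbar * Lbar * Lbar)%type.

Definition ninf (u : Lbar) : nat := match u with Fin _ => 0 | _ => 1 end.
Lemma ninf_neg u : ninf (negbar u) = ninf u.
Proof. destruct u; reflexivity. Qed.

Definition cellP (p : point) : Prop :=
  let '(x, y, z) := p in ninf x + ninf y + ninf z = 1.
Definition cell : Type := {p : point | cellP p}.

Inductive axis : Type := AX | AY | AZ.

Definition rot (i : axis) (a : Lbar) (p : point) : point :=
  let '(x, y, z) := p in
  match i with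
  | AX => if dec (x = a) then (x, negbar z, y) else p
  | AY => if dec (y = a) then (z, y, negbar x) else p
  | AZ => if dec (z = a) then (negbar y, x, z) else p
  end.

Lemma rot_cell i a p : cellP p -> cellP (rot i a p).
Proof.
destruct p as [[x y] z]; unfold cellP, rot.
destruct i; destruct dec; simpl; rewrite ?ninf_neg; lia.
Qed.

Definition rotc (i : axis) (a : Lbar) (c : cell) : cell :=
  exist _ (rot i a (proj1_sig c)) (@rot_cell i a (proj1_sig c) (proj2_sig c)).

Inductive power : Type := P1 | P2 | P3.
Record btwist : Type := BTwist { bt_axis : axis; bt_pos : Lbar; bt_pow : power }.

(* exponent of the inverse: (T^k)^{-1} = T^(4-k) *)
Definition inv_exp (k : power) : nat := match k with P1 => 3 | P2 => 2 | P3 => 1 end.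

Definition bt_inv (s : btwist) (c : cell) : cell :=
  Nat.iter (inv_exp (bt_pow s)) (rotc (bt_axis s) (bt_pos s)) c.

Inductive color : Type := red | white | green | orange | yellow | blue.

(* configurations; None = NaC *)
Definition config : Type := cell -> option color.

Definition legal (f : config) : Prop := forall c, f c <> None.

Definition act (s : btwist) (f : config) : config := fun c => f (bt_inv s c).

Definition solved_pt (p : point) : color :=
  let '(x, y, z) := p in
  match x with
  | PInf => red
  | MInf => orange
  | Fin _ =>
    match y with
    | PInf => blue
    | MInf => green
    | Fin _ => match z with PInf => white | _ => yellow end
    end
  end.

Definition f_solved : config := fun c => Some (solved_pt (proj1_sig c)).

End Cube.

(* Ordinal lengths are represented by (strict) well-orders. *)
Record wellorder : Type := WellOrder {
  wo_car :> Type;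
  wo_lt : wo_car -> wo_car -> Prop;
  wo_trans : forall a b c, wo_lt a b -> wo_lt b c -> wo_lt a c;
  wo_total : forall a b, wo_lt a b \/ a = b \/ wo_lt b a;
  wo_wf : well_founded wo_lt
}.

(* positions 0 .. theta : an element of the index set, or None = theta *)
Definition pos_lt (W : wellorder) (p q : option W) : Prop :=
  match p, q with
  | Some a, Some b => wo_lt W a b
  | Some _, None => True
  | None, _ => False
  end.

Arguments pos_lt {W} p q.

Section Run.
Variable L : Type.
Variable W : wellorder.
Variable s : W -> btwist L.
Variable f0 : config L.

Definition is_run (F : option W -> config L) : Prop :=
  forall p : option W,
    ((forall q, ~ pos_lt q p) -> F p = f0)
 /\ (forall a, pos_lt (Some a) p ->
       (forall r, ~ (pos_lt (Some a) r /\ pos_lt r p)) ->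
       F p = act (s a) (F (Some a)))
 /\ ((exists q, pos_lt q p) ->
     (forall q, pos_lt q p -> exists r, pos_lt q r /\ pos_lt r p) ->
     forall c,
       (forall q, pos_lt q p ->
          (forall r, pos_lt q r -> pos_lt r p -> F r c = F q c) ->
          F p c = F q c)
    /\ ((forall q, pos_lt q p -> exists r, pos_lt q r /\ pos_lt r p /\ F r c <> F q c) ->
          F p c = None)).

Definition terminal (f : config L) : Prop :=
  exists F, is_run F /\ F None = f.
End Run.

Definition accessible (L : Type) (f0 f : config L) : Prop :=
  exists (W : wellorder) (s : W -> btwist L), @terminal L W s f0 f.

(* lexicographic order on nat * nat, of order type omega^2 *)
Definition lex_lt (u v : nat * nat) : Prop :=
  fst u < fst v \/ (fst u = fst v /\ snd u < snd v).

Definition le_omega2 (W : wellorder) : Prop :=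
  exists g : W -> nat * nat, forall a b, wo_lt W a b -> lex_lt (g a) (g b).

(* Main.v *)
From Stdlib Require Import Arith Lia List Bool Permutation Classical ClassicalEpsilon.
From Stdlib Require Import FunctionalExtensionality Wellfounded.
Require Import Defs.
Import ListNotations.

Set Implicit Arguments.

(* A cell with an infinite coordinate and finite coordinates of absolute values [a], [b] stays
   in the cluster of the 24 images of [(infinity, a, b)] under rotations of the cube. As
   clusters are finite, a legal accessible colouring is obtained, on each cluster separately, by
   a finite word from the solved one; so every colour has the right multiplicity, and the six
   centres can be solved at once by the inverse of their word.

   The other clusters are solved row by row. Given [a], the commutator of the slice [y = a]
   with the face-conjugate of the product of all slices [y = b], [b] in [S], acts as a 3-cycle on
   each cluster of [(infinity, a, b)], [b] in [S], and trivially elsewhere. Conjugates of it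
   realize all 3-cycles, and on each cluster at most 24 suffice to sort the colours. Choosing
   for each word of a finite list the set [S] of those [b] that profit from it, all clusters
   containing [a] are solved by finitely many words, whose letters are products of at most [omega]
   moves. Once the rows of both coordinates of a cell are done, only face twists still move it,
   within its solved cluster, so that the configuration converges at [omega^2]. *)

(** * Words of twists on triples *)

Section Words.
Context {T Tag : Type} (neg : T -> T) (d : Tag -> T -> bool).

Definition crd (i : axis) (p : T * T * T) : T :=
  let '(x, y, z) := p in match i with AX => x | AY => y | AZ => z end.

Definition turn (i : axis) (p : T * T * T) : T * T * T :=
  let '(x, y, z) := p in
  match i with
  | AX => (x, neg z, y)
  | AY => (z, y, neg x)
  | AZ => (neg y, x, z)
  end.

(** A tag stands for a set of positions decided by [d]; a letter turns all slices of its axis at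
    these positions at once. *)
Definition letter : Type := (axis * Tag * power)%type.

(* The inverse twist, as configurations are acted upon by precomposition. *)
Definition tw (l : letter) (p : T * T * T) : T * T * T :=
  let '(i, t, k) := l in
  if d t (crd i p) then Nat.iter (inv_exp k) (turn i) p else p.

(* Applying the word [w] from left to right turns [g] into [fun p => g (pull w p)]. *)
Definition pull (w : list letter) (p : T * T * T) : T * T * T :=
  fold_right tw p w.

Definition linv (l : letter) : letter :=
  let '(i, t, k) := l in
  (i, t, match k with P1 => P3 | P2 => P2 | P3 => P1 end).

Definition winv (w : list letter) : list letter := rev (map linv w).

Lemma pull_app w1 w2 p : pull (w1 ++ w2) p = pull w1 (pull w2 p).
Proof. apply fold_right_app. Qed.

Lemma crd_turn i n p : crd i (Nat.iter n (turn i) p) = crd i p.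
Proof.
induction n as [|n IH]; [reflexivity|].
rewrite <- IH; simpl.
destruct (Nat.iter n (turn i) p) as [[x y] z]; destruct i; reflexivity.
Qed.

Lemma linvK l : linv (linv l) = l.
Proof. destruct l as [[i t] []]; reflexivity. Qed.

Lemma winvK w : winv (winv w) = w.
Proof.
unfold winv. rewrite map_rev, rev_involutive, map_map.
rewrite (map_ext _ id); [apply map_id | apply linvK].
Qed.

Hypothesis negK : forall x, neg (neg x) = x.

Lemma tw_linv l p : tw l (tw (linv l) p) = p.
Proof.
destruct l as [[i t] k]; simpl.
destruct (d t (crd i p)) eqn:E; [|rewrite E; reflexivity].
rewrite crd_turn, E.
destruct p as [[x y] z].
destruct i, k; simpl; rewrite ?negK; reflexivity.
Qed.

Lemma pull_winv w p : pull w (pull (winv w) p) = p.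
Proof.
revert p; induction w as [|l w IH]; intros p; [reflexivity|].
change (winv (l :: w)) with (winv w ++ [linv l]). rewrite pull_app.
change (tw l (pull w (pull (winv w) (tw (linv l) p))) = p).
rewrite IH. apply tw_linv.
Qed.

Lemma winv_pull w p : pull (winv w) (pull w p) = p.
Proof. rewrite <- (winvK w) at 2. apply pull_winv. Qed.

End Words.

(** * Transporting words along renamings of coordinates *)

Definition map3 {T U : Type} (h : T -> U) (p : T * T * T) : U * U * U :=
  let '(x, y, z) := p in (h x, h y, h z).

Lemma crd_map3 T U (h : T -> U) i p : crd i (map3 h p) = h (crd i p).
Proof. destruct p as [[x y] z]; destruct i; reflexivity. Qed.

Lemma turn_map3 T U (h : T -> U) negT negU
  (hneg : forall x, h (negT x) = negU (h x)) i n p :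
  Nat.iter n (turn negU i) (map3 h p) = map3 h (Nat.iter n (turn negT i) p).
Proof.
induction n as [|n IH]; [reflexivity|]. simpl. rewrite IH.
destruct (Nat.iter n (turn negT i) p) as [[x y] z].
destruct i; simpl; rewrite ?hneg; reflexivity.
Qed.

Lemma tw_map3 T U Tag (h : T -> U) negT negU (dT : Tag -> T -> bool) (dU : Tag -> U -> bool)
  (hneg : forall x, h (negT x) = negU (h x))
  (hd : forall t x, dU t (h x) = dT t x) l p :
  tw negU dU l (map3 h p) = map3 h (tw negT dT l p).
Proof.
destruct l as [[i t] k]; simpl. rewrite crd_map3, hd.
destruct (dT t (crd i p)); [apply turn_map3; exact hneg | reflexivity].
Qed.

(** Carries computations on symbolic cells over to cells of the cube, with [ev u v] as the
    renaming. *)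
Lemma pull_map3 T U Tag (h : T -> U) negT negU (dT : Tag -> T -> bool) (dU : Tag -> U -> bool)
  (hneg : forall x, h (negT x) = negU (h x))
  (hd : forall t x, dU t (h x) = dT t x) w p :
  pull negU dU w (map3 h p) = map3 h (pull negT dT w p).
Proof.
induction w as [|l w IH]; [reflexivity|]. simpl. rewrite IH.
apply tw_map3; assumption.
Qed.

(** * The cluster of 24 cells *)

(** [SI] stands for infinity, [SA] and [SB] for the finite coordinates [u] and [v] of a cluster; the
    boolean of an [ssym] is its sign, [true] meaning plus. *)
Inductive sym : Type := SI | SA | SB.
Definition ssym : Type := (sym * bool)%type.
Definition sneg (s : ssym) : ssym := (fst s, negb (snd s)).
Definition aptype : Type := (ssym * ssym * ssym)%type.

Definition ssym_eqb (s t : ssym) : bool :=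
  match fst s, fst t with
  | SI, SI | SA, SA | SB, SB => eqb (snd s) (snd t)
  | _, _ => false
  end.

Definition eqp (p q : aptype) : bool :=
  let '(x, y, z) := p in let '(x', y', z') := q in
  ssym_eqb x x' && ssym_eqb y y' && ssym_eqb z z'.

Lemma eqpP p q : eqp p q = true <-> p = q.
Proof.
assert (H : forall s t, ssym_eqb s t = true <-> s = t).
{ intros [[] []] [[] []]; split; intros E; reflexivity || discriminate E. }
destruct p as [[x y] z], q as [[x' y'] z']. simpl.
rewrite !andb_true_iff, !H. split; [intros [[-> ->] ->]; reflexivity | intros [= -> -> ->]; auto].
Qed.

Lemma apt_eq_dec (p q : aptype) : {p = q} + {p <> q}.
Proof.
destruct (eqp p q) eqn:E; [left | right].
- apply eqpP, E.
- intros H. apply eqpP in H. congruence.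
Defined.

Lemma snegK s : sneg (sneg s) = s.
Proof. destruct s as [s []]; reflexivity. Qed.

(** The three cells that [comm_word] permutes cyclically. *)
Definition p0 : aptype := ((SI, true), (SA, true), (SB, true)).
Definition p1 : aptype := ((SB, false), (SA, true), (SI, true)).
Definition p2 : aptype := ((SA, true), (SB, true), (SI, true)).

Definition quarter (i : axis) (n : nat) : aptype -> aptype := Nat.iter n (turn sneg i).

(** The six turns listed represent the cosets of the turns about the x axis, so each of the 24
    rotations is applied to [p0] once. *)
Definition orb24 : list aptype :=
  flat_map (fun p => map (fun n => quarter AX n p) (seq 0 4))
    (map (fun n => quarter AZ n p0) (seq 0 4) ++ [quarter AY 1 p0; quarter AY 3 p0]).

Definition mem (p : aptype) (l : list aptype) : bool := existsb (eqp p) l.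

Lemma memP p l : mem p l = true <-> In p l.
Proof.
unfold mem. rewrite existsb_exists. split.
- intros [q [Hq E]]. apply eqpP in E. subst. exact Hq.
- intros H. exists p. split; [exact H | apply eqpP; reflexivity].
Qed.

Definition add (l : list aptype) (p : aptype) : list aptype := if mem p l then l else p :: l.

Lemma add_in l p q : In q (add l p) <-> q = p \/ In q l.
Proof.
unfold add. destruct (mem p l) eqn:E; simpl; intuition.
subst. apply memP, E.
Qed.

Lemma orb24_nodup : NoDup orb24.
Proof.
assert (H : forall l m, NoDup m -> NoDup (fold_left add l m)).
{ induction l as [|p l IH]; intros m Hm; [exact Hm|]. apply IH.
  unfold add. destruct (mem p m) eqn:E; [exact Hm|]. constructor; [|exact Hm].
  rewrite <- memP. congruence. }
rewrite <- (rev_involutive orb24). apply NoDup_rev.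
(* [add] would drop repetitions; the computation shows that there are none. *)
replace (rev orb24) with (fold_left add orb24 []) by (vm_compute; reflexivity).
apply H. constructor.
Qed.

Definition check24 (P : aptype -> bool) : bool := forallb P orb24.

Lemma check24P P : check24 P = true -> forall p, In p orb24 -> P p = true.
Proof. intros H. apply forallb_forall. exact H. Qed.

Lemma turn_orb24 i n p : In p orb24 -> In (Nat.iter n (turn sneg i) p) orb24.
Proof.
intros H. induction n as [|n IH]; [exact H|].
change (In (turn sneg i (Nat.iter n (turn sneg i) p)) orb24).
apply memP. revert IH. generalize (Nat.iter n (turn sneg i) p).
apply check24P. destruct i; vm_compute; reflexivity.
Qed.

Lemma tw_orb24 Tag (d : Tag -> ssym -> bool) l p :
  In p orb24 -> In (tw sneg d l p) orb24.
Proof.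
intros H. destruct l as [[i t] k]; simpl.
destruct (d t (crd i p)); [apply turn_orb24|]; exact H.
Qed.

Lemma pull_orb24 Tag (d : Tag -> ssym -> bool) w p :
  In p orb24 -> In (pull sneg d w p) orb24.
Proof.
intros H. induction w as [|l w IH]; [exact H|]. apply tw_orb24, IH.
Qed.

Lemma pull_perm Tag (d : Tag -> ssym -> bool) w :
  Permutation (map (pull sneg d w) orb24) orb24.
Proof.
apply NoDup_Permutation_bis.
- apply FinFun.Injective_map_NoDup; [|apply orb24_nodup].
  intros p q H. rewrite <- (winv_pull sneg d snegK w p), H. apply winv_pull, snegK.
- rewrite length_map; lia.
- intros q H. apply in_map_iff in H. destruct H as [p [<- H]].
  apply pull_orb24, H.
Qed.

(* Which of the coordinates [u], [-u], [v], [-v] of the cluster of [(infinity, u, v)] equal [a]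
   or lie in [S]: [uA true] stands for [u = a], [uA false] for [-u = a], [uB true] for
   [u] in [S], and so on. *)
Record bits : Type := Bits { uA : bool -> bool; uB : bool -> bool; vA : bool -> bool; vB : bool -> bool }.

Definition mt (b : bits) (t s : ssym) : bool :=
  match fst t, fst s with
  | SI, SI => eqb (snd t) (snd s)
  | SA, SA => uA b (eqb (snd t) (snd s))
  | SB, SA => uB b (eqb (snd t) (snd s))
  | SA, SB => vA b (eqb (snd t) (snd s))
  | SB, SB => vB b (eqb (snd t) (snd s))
  | _, _ => false
  end.

Definition apull (b : bits) (w : list (@letter ssym)) : aptype -> aptype := pull sneg (mt b) w.

(* [A; B'; A^-1; B'^-1] with [A] the slice [y = a] and [B'] the slices [y = b], [b] in [S],
   conjugated by a turn of the face [x = infinity]. Their supports meet only in the cells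
   [(infinity, a, b)], so the commutator is a product of 3-cycles. *)
Definition comm_word : list (@letter ssym) :=
  [(AY, (SA, true), P1);
   (AX, (SI, true), P3); (AY, (SB, true), P1); (AX, (SI, true), P1);
   (AY, (SA, true), P3);
   (AX, (SI, true), P3); (AY, (SB, true), P3); (AX, (SI, true), P1)].

Definition bit2 (x y : bool) (b : bool) : bool := if b then x else y.

(** The patterns of the cluster of (infinity, a, b) with b in S: the general one, the one for a =
    -a, and the one for b = -a. *)
Definition kind_generic := Bits (bit2 true false) (bit2 false false) (bit2 false false) (bit2 true false).
Definition kind_cross := Bits (bit2 true true) (bit2 false false) (bit2 false false) (bit2 true false).
Definition kind_diag := Bits (bit2 true false) (bit2 false true) (bit2 false true) (bit2 true false).
Definition kinds : list bits := [kind_generic; kind_cross; kind_diag].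

Definition cyc3 (x y z p : aptype) : aptype :=
  if apt_eq_dec p x then y else if apt_eq_dec p y then z else if apt_eq_dec p z then x else p.

Lemma comm_word_cycle b p : In b kinds -> In p orb24 -> apull b comm_word p = cyc3 p0 p1 p2 p.
Proof.
intros Hb Hp. apply eqpP. revert p Hp. apply check24P. revert b Hb.
apply (forallb_forall (fun b => check24 (fun p => eqp (apull b comm_word p) (cyc3 p0 p1 p2 p)))).
vm_compute; reflexivity.
Qed.

(** The pairs (u, v), (-v, u), (-u, -v), (v, -u) name the same cluster; none of them may have the
    form (a, b) with b in S. *)
Definition off_target (b : bits) : bool :=
  negb (uA b true && vB b true || vA b false && uB b true
        || uA b false && vB b false || vA b true && uB b false).

Definition disjoint_bits (b : bits) : bool :=
  negb (uA b true && uB b true || uA b false && uB b false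
        || vA b true && vB b true || vA b false && vB b false).

(** Replaces functions on [bool] by tables, so that eight boolean case distinctions exhaust all
    patterns. *)
Lemma bits_eta b w p :
  apull b w p = apull (Bits (bit2 (uA b true) (uA b false)) (bit2 (uB b true) (uB b false))
                     (bit2 (vA b true) (vA b false)) (bit2 (vB b true) (vB b false))) w p.
Proof.
unfold apull. induction w as [|[[i t] k] w IH]; [reflexivity|].
simpl. rewrite IH.
match goal with |- context [crd i ?q] => generalize q end. intros q.
replace (mt b t (crd i q)) with
 (mt (Bits (bit2 (uA b true) (uA b false)) (bit2 (uB b true) (uB b false))
                     (bit2 (vA b true) (vA b false)) (bit2 (vB b true) (vB b false))) t (crd i q));
 [reflexivity|].
destruct t as [t1 t2], (crd i q) as [s1 s2]; unfold mt; simpl.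
destruct t1, s1, (eqb t2 s2); reflexivity.
Qed.

Lemma comm_word_off b p :
  off_target b = true -> disjoint_bits b = true -> In p orb24 -> apull b comm_word p = p.
Proof.
intros H1 H2 Hp. rewrite bits_eta.
unfold off_target, disjoint_bits in *.
apply eqpP. revert p Hp. apply check24P. revert H1 H2.
destruct (uA b true), (uA b false), (uB b true), (uB b false),
  (vA b true), (vA b false), (vB b true), (vB b false);
  intros H1 H2; try discriminate H1; try discriminate H2; vm_compute; reflexivity.
Qed.

(** * All 3-cycles of a cluster are conjugates of the commutator *)

Definition quarter_letters : list (@letter ssym) :=
  flat_map (fun i => flat_map (fun s => [(i, (s, true), P1); (i, (s, false), P1)]) [SI; SA; SB])
    [AX; AY; AZ].

(** Words in these letters lie in the pointwise stabilizer of [ps]; [grow] collects cells that such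
    words reach. *)
Definition fixers (b : bits) (ps : list aptype) : list (@letter ssym) :=
  filter (fun l => forallb (fun p => eqp (tw sneg (mt b) l p) p) ps) quarter_letters.

Fixpoint grow (b : bits) (ps : list aptype) (n : nat) (l : list aptype) : list aptype :=
  match n with
  | 0 => l
  | S n => grow b ps n
      (fold_left (fun m c => fold_left add (map (tw sneg (mt b) c) m) m) (fixers b ps) l)
  end.

Definition reach (b : bits) (ps : list aptype) (q r : aptype) : Prop :=
  exists u, (forall p, In p ps -> apull b u p = p) /\ apull b u q = r.

Lemma fold_left_add l m p : In p (fold_left add l m) -> In p l \/ In p m.
Proof.
revert m. induction l as [|q l IH]; intros m H; [right; exact H|].
apply IH in H. rewrite add_in in H. simpl. intuition.
Qed.

Lemma grow_reach b ps q n l :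
  (forall r, In r l -> reach b ps q r) -> forall r, In r (grow b ps n l) -> reach b ps q r.
Proof.
revert l. induction n as [|n IH]; intros l Hl; [exact Hl|].
simpl. apply IH. clear IH n.
assert (Hf : forall c, In c (fixers b ps) -> forall p, In p ps -> tw sneg (mt b) c p = p).
{ intros c Hc p Hp. apply filter_In in Hc. destruct Hc as [_ Hc].
  rewrite forallb_forall in Hc. apply eqpP, Hc, Hp. }
revert l Hl Hf. generalize (fixers b ps) as cs.
induction cs as [|c cs IH]; intros l Hl Hf; [exact Hl|].
simpl. apply IH; [|intros; apply Hf; simpl; auto].
intros r Hr. apply fold_left_add in Hr. destruct Hr as [Hr|Hr]; [|exact (Hl r Hr)].
apply in_map_iff in Hr. destruct Hr as [t [<- Ht]].
destruct (Hl t Ht) as [u [Hu1 Hu2]].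
exists (c :: u). split.
- intros p Hp. change (tw sneg (mt b) c (apull b u p) = p).
  rewrite (Hu1 p Hp). apply Hf; simpl; auto.
- change (tw sneg (mt b) c (apull b u q) = tw sneg (mt b) c t). rewrite Hu2. reflexivity.
Qed.

Lemma reach_check b ps q :
  check24 (fun r => mem r (ps ++ grow b ps 4 [q])) = true ->
  forall r, In r orb24 -> ~ In r ps -> reach b ps q r.
Proof.
intros H r Hr Hn. apply (check24P _ H), memP in Hr. rename Hr into Hi.
apply in_app_iff in Hi. destruct Hi as [Hi|Hi]; [contradiction|].
apply grow_reach with (2 := Hi). intros t [<-|[]].
exists []. split; reflexivity.
Qed.

(** Four rounds of [grow] exhaust the orbits along the stabilizer chain of [p0], [p1], which is what
    3-transitivity requires. *)
Lemma reach_all b : In b kinds ->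
  (forall r, In r orb24 -> reach b [] p0 r) /\
  (forall r, In r orb24 -> r <> p0 -> reach b [p0] p1 r) /\
  (forall r, In r orb24 -> r <> p0 -> r <> p1 -> reach b [p0; p1] p2 r).
Proof.
intros Hb.
repeat split; intros r Hr; intros; (apply reach_check; [|exact Hr|intros [?|[?|[]]] || intros [?|[]] || intros []; congruence]);
 revert b Hb;
 match goal with |- forall b, In b kinds -> @?P b = true => apply (proj1 (forallb_forall P kinds)) end;
 vm_compute; reflexivity.
Qed.

Lemma apull_winv b u p : apull b u (apull b (winv u) p) = p.
Proof. apply pull_winv, snegK. Qed.

Lemma winv_apull b u p : apull b (winv u) (apull b u p) = p.
Proof. apply winv_pull, snegK. Qed.

Lemma apull_app b u v p : apull b (u ++ v) p = apull b u (apull b v p).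
Proof. apply pull_app. Qed.

Lemma apull_orb24 b u p : In p orb24 -> In (apull b u p) orb24.
Proof. apply pull_orb24. Qed.

(** The images are matched one at a time: [u2] fixes [p0], and [u3] fixes [p0] and [p1], so no
    factor spoils what is already matched. *)
Lemma three_transitive b x y z : In b kinds ->
  In x orb24 -> In y orb24 -> In z orb24 -> x <> y -> y <> z -> x <> z ->
  exists u, apull b u p0 = x /\ apull b u p1 = y /\ apull b u p2 = z.
Proof.
intros Hb Hx Hy Hz xy yz xz.
destruct (reach_all Hb) as (R1 & R2 & R3).
destruct (R1 x Hx) as [u1 [_ E1]].
destruct (R2 (apull b (winv u1) y)) as [u2 [F2 E2]].
{ apply apull_orb24, Hy. }
{ intros E. apply xy. rewrite <- E1, <- E. apply apull_winv. }
assert (E12 : apull b (u1 ++ u2) p0 = x).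
{ rewrite apull_app, F2 by (simpl; auto). exact E1. }
assert (E12' : apull b (u1 ++ u2) p1 = y).
{ rewrite apull_app, E2. apply apull_winv. }
destruct (R3 (apull b (winv (u1 ++ u2)) z)) as [u3 [F3 E3]].
{ apply apull_orb24, Hz. }
{ intros E. apply xz. rewrite <- E12, <- E. apply apull_winv. }
{ intros E. apply yz. rewrite <- E12', <- E. apply apull_winv. }
exists ((u1 ++ u2) ++ u3). rewrite !(apull_app _ (u1 ++ u2)).
rewrite E3, !F3 by (simpl; auto). rewrite apull_winv. auto.
Qed.

Definition conj_word (u : list (@letter ssym)) : list (@letter ssym) := u ++ comm_word ++ winv u.

Lemma conj_word_cycle b u p : In b kinds -> In p orb24 ->
  apull b (conj_word u) p = cyc3 (apull b u p0) (apull b u p1) (apull b u p2) p.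
Proof.
intros Hb Hp. unfold conj_word. rewrite !apull_app.
rewrite comm_word_cycle; [|exact Hb|apply apull_orb24, Hp].
assert (E : forall q, apull b (winv u) p = q <-> p = apull b u q).
{ intros q; split; [intros <-; symmetry; apply apull_winv | intros ->; apply winv_apull]. }
unfold cyc3.
destruct (apt_eq_dec (apull b (winv u) p) p0) as [e|n0];
 destruct (apt_eq_dec p (apull b u p0)) as [e'|n0']; rewrite E in *; try contradiction;
 [reflexivity|].
destruct (apt_eq_dec (apull b (winv u) p) p1) as [e|n1];
 destruct (apt_eq_dec p (apull b u p1)) as [e'|n1']; rewrite E in *; try contradiction;
 [reflexivity|].
destruct (apt_eq_dec (apull b (winv u) p) p2) as [e|n2];
 destruct (apt_eq_dec p (apull b u p2)) as [e'|n2']; rewrite E in *; try contradiction;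
 [reflexivity|].
apply apull_winv.
Qed.

Lemma conj_word_off b u p : off_target b = true -> disjoint_bits b = true ->
  In p orb24 -> apull b (conj_word u) p = p.
Proof.
intros H1 H2 Hp. unfold conj_word. rewrite !apull_app, comm_word_off; auto.
- apply apull_winv.
- apply apull_orb24, Hp.
Qed.

Lemma finite_choice A B (P : A -> B -> Prop) (l : list A) :
  (forall a, In a l -> exists w, P a w) ->
  exists ws, forall a, In a l -> exists w, In w ws /\ P a w.
Proof.
induction l as [|a l IH]; intros H.
- exists []. intros a [].
- destruct IH as [ws Hws]; [intros; apply H; right; assumption|].
  destruct (H a) as [w Hw]; [left; reflexivity|].
  exists (w :: ws). intros c [<-|Hc].
  + exists w; simpl; auto.
  + destruct (Hws c Hc) as [v [Hv1 Hv2]]. exists v; simpl; auto.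
Qed.

(** Only finitely many kinds and triples occur, so one finite list of words serves all clusters,
    however many there are. *)
Lemma cycle_words : exists us, forall b x y z, In b kinds ->
  In x orb24 -> In y orb24 -> In z orb24 -> x <> y -> y <> z -> x <> z ->
  exists u, In u us /\ forall p, In p orb24 -> apull b (conj_word u) p = cyc3 x y z p.
Proof.
destruct (@finite_choice _ _
  (fun (a : bits * (aptype * (aptype * aptype))) u =>
     let '(b, (x, (y, z))) := a in x <> y -> y <> z -> x <> z ->
     forall p, In p orb24 -> apull b (conj_word u) p = cyc3 x y z p)
  (list_prod kinds (list_prod orb24 (list_prod orb24 orb24)))) as [us Hus].
- intros [b [x [y z]]] H. rewrite !in_prod_iff in H. destruct H as (Hb & Hx & Hy & Hz).
  destruct (apt_eq_dec x y) as [e|xy]; [exists []; contradiction|].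
  destruct (apt_eq_dec y z) as [e|yz]; [exists []; contradiction|].
  destruct (apt_eq_dec x z) as [e|xz]; [exists []; contradiction|].
  destruct (three_transitive Hb Hx Hy Hz xy yz xz) as [u (E1 & E2 & E3)].
  exists u. intros _ _ _ p Hp. rewrite conj_word_cycle, E1, E2, E3; auto.
- exists us. intros b x y z Hb Hx Hy Hz xy yz xz.
  destruct (Hus (b, (x, (y, z)))) as [u [Hu1 Hu2]].
  + rewrite !in_prod_iff. auto.
  + exists u. auto.
Qed.

(** * Sorting the colours of a cluster by 3-cycles *)

Definition scol (p : aptype) : color :=
  let '(x, y, z) := p in
  match fst x, fst y with
  | SI, _ => if snd x then red else orange
  | _, SI => if snd y then blue else green
  | _, _ => if snd z then white else yellow
  end.

Definition coloring : Type := aptype -> option color.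

Definition bad (chi : coloring) (p : aptype) : bool :=
  if dec (chi p = Some (scol p)) then false else true.

Definition wrong (chi : coloring) : nat := length (filter (bad chi) orb24).

(** Colour counts suffice for sorting: each colour occurs four times, so parity is no obstruction to
    the use of 3-cycles. *)
Definition balanced (chi : coloring) : Prop :=
  Permutation (map chi orb24) (map (fun p => Some (scol p)) orb24).

Lemma bad_false chi p : bad chi p = false <-> chi p = Some (scol p).
Proof. unfold bad; destruct dec; split; congruence. Qed.

Lemma wrong0 chi : wrong chi = 0 <-> forall p, In p orb24 -> chi p = Some (scol p).
Proof.
unfold wrong. split.
- intros H p Hp. apply bad_false. destruct (bad chi p) eqn:E; [|reflexivity].
  apply length_zero_iff_nil in H.
  assert (F : In p (filter (bad chi) orb24)) by (apply filter_In; auto).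
  rewrite H in F. destruct F.
- intros H. apply length_zero_iff_nil.
  destruct (filter (bad chi) orb24) as [|p l] eqn:E; [reflexivity|].
  assert (F : In p (filter (bad chi) orb24)) by (rewrite E; left; reflexivity).
  apply filter_In in F. destruct F as [F1 F2].
  apply H, bad_false in F1. congruence.
Qed.

Lemma filter_length_lt A (P Q : A -> bool) l a :
  (forall x, In x l -> Q x = true -> P x = true) ->
  In a l -> P a = true -> Q a = false ->
  length (filter Q l) < length (filter P l).
Proof.
intros H Ha HP HQ.
assert (LE : forall m, incl m l -> length (filter Q m) <= length (filter P m)).
{ induction m as [|x m IH]; intros Hm; [simpl; lia|].
  assert (IH' := IH (fun y Hy => Hm y (or_intror Hy))).
  assert (Hx := H x (Hm x (or_introl eq_refl))). simpl.
  destruct (Q x); [rewrite Hx by reflexivity|destruct (P x)]; simpl; lia. }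
destruct (in_split a l Ha) as (l1 & l2 & ->).
rewrite !filter_app, !length_app. simpl. rewrite HP, HQ. simpl.
assert (L1 := LE l1 (incl_appl _ (incl_refl _))).
assert (L2 := LE l2 (fun x Hx => in_or_app l1 (a :: l2) x (or_intror (or_intror Hx)))).
lia.
Qed.

Lemma filter_map_length A B (h : A -> B) (P : B -> bool) l :
  length (filter P (map h l)) = length (filter (fun x => P (h x)) l).
Proof. induction l as [|x l IH]; [reflexivity|]. simpl; destruct (P (h x)); simpl; lia. Qed.

Lemma filter_perm_length A (P : A -> bool) l m :
  Permutation l m -> length (filter P l) = length (filter P m).
Proof.
induction 1; simpl; repeat match goal with |- context [if ?b then _ else _] => destruct b end;
 simpl; lia.
Qed.

Lemma color_eq_dec (c c' : color) : {c = c'} + {c <> c'}.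
Proof. decide equality. Defined.

Lemma same_color p : In p orb24 -> exists r, In r orb24 /\ r <> p /\ scol r = scol p.
Proof.
intros Hp.
assert (H : existsb (fun r => negb (eqp r p) && (if color_eq_dec (scol r) (scol p) then true else false))
                    orb24 = true).
{ revert p Hp. apply check24P. vm_compute. reflexivity. }
apply existsb_exists in H. destruct H as [r [Hr H]].
exists r. apply andb_true_iff in H. destruct H as [H1 H2].
destruct (color_eq_dec (scol r) (scol p)); [|discriminate]. repeat split; auto.
intros E. apply eqpP in E. rewrite E in H1. discriminate.
Qed.

(** By counting: if the colour of [p] were found only on its own face, where [p] itself lacks it, it
    would occur less often than in the solved state. *)
Lemma source_of_color chi p : balanced chi -> In p orb24 -> chi p <> Some (scol p) ->
  exists q, In q orb24 /\ chi q = Some (scol p) /\ scol q <> scol p.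
Proof.
intros Hb Hp Hn.
destruct (classic (exists q, In q orb24 /\ chi q = Some (scol p) /\ scol q <> scol p)) as [|H];
 [assumption|exfalso].
pose (P := fun o : option color => if dec (o = Some (scol p)) then true else false).
assert (E := filter_perm_length P Hb). rewrite !filter_map_length in E.
apply (Nat.lt_irrefl (length (filter (fun x => P (chi x)) orb24))).
rewrite E at 2.
apply filter_length_lt with (a := p); auto; unfold P.
- intros q Hq. destruct (dec (chi q = _)) as [e|]; [|discriminate]. intros _.
  destruct dec as [|n]; [reflexivity|].
  exfalso. apply H. exists q. repeat split; auto. congruence.
- destruct dec; congruence.
- destruct dec; congruence.
Qed.

(* Besides a wrong cell [p] and a wrong cell [q] carrying the colour of [p], the third cell
   of the cycle is any other [r] whose solved colour is that of [p]: a wrong [r] has nothing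
   to lose, and a right [r] may give its colour to [p] and take the same colour from [q]. *)
Lemma improve chi : balanced chi -> wrong chi <> 0 ->
  exists x y z, In x orb24 /\ In y orb24 /\ In z orb24 /\ x <> y /\ y <> z /\ x <> z /\
    wrong (fun p => chi (cyc3 x y z p)) < wrong chi.
Proof.
intros Hb Hw.
assert (exists p, In p orb24 /\ chi p <> Some (scol p)) as (p & Hp & Hn).
{ apply NNPP. intros H. apply Hw, wrong0. intros p Hp. apply NNPP. intros Hn.
  apply H. exists p; auto. }
destruct (source_of_color Hb Hp Hn) as (q & Hq & Eq & Nq).
destruct (same_color Hp) as (r & Hr & Nr & Er).
assert (pq : p <> q) by congruence.
assert (qr : q <> r) by congruence.
(* The cycle gives [x] the colour of [y], [y] that of [z] and [z] that of [x]. So [x] becomes right,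
   and [y] and [z] impose a condition only if they were right before. *)
assert (main : forall x y z, In x orb24 -> In y orb24 -> In z orb24 -> x <> y -> y <> z -> x <> z ->
  x = p -> chi y = Some (scol p) ->
  (bad chi y = true \/ chi z = Some (scol y)) -> bad chi z = true \/ chi x = Some (scol z) ->
  wrong (fun p => chi (cyc3 x y z p)) < wrong chi).
{ intros x y z Hx Hy Hz xy yz xz -> Ey Ky Kz.
  apply filter_length_lt with (a := p); auto.
  - intros t Ht. destruct (bad chi t) eqn:B; [auto|]. intros F. exfalso.
    assert (Bt := proj1 (bad_false _ _) B).
    unfold bad, cyc3 in F. destruct dec as [|n] in F; [discriminate|]. apply n.
    destruct (apt_eq_dec t p) as [->|]; [congruence|].
    destruct (apt_eq_dec t y) as [->|]; [destruct Ky; congruence|].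
    destruct (apt_eq_dec t z) as [->|]; [destruct Kz; congruence|]. exact Bt.
  - unfold bad; destruct dec; congruence.
  - apply bad_false. unfold cyc3. destruct apt_eq_dec; congruence. }
assert (Bq : bad chi q = true) by (unfold bad; destruct dec; congruence).
destruct (bad chi r) eqn:Br.
- exists p, q, r. repeat (split; [solve [auto]|]). apply main; auto.
- apply bad_false in Br.
  exists p, r, q. repeat (split; [solve [auto]|]). apply main; auto; try congruence. right; congruence.
Qed.

Lemma wrong_ext chi psi : (forall p, In p orb24 -> chi p = psi p) -> wrong chi = wrong psi.
Proof.
intros H. apply (f_equal (@length _)), filter_ext_in. intros p Hp. unfold bad.
rewrite (H p Hp). reflexivity.
Qed.

Lemma improving_words : exists us, forall b chi, In b kinds -> balanced chi -> wrong chi <> 0 ->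
  exists u, In u us /\ wrong (fun p => chi (apull b (conj_word u) p)) < wrong chi.
Proof.
destruct cycle_words as [us Hus]. exists us. intros b chi Hb Hc Hw.
destruct (improve Hc Hw) as (x & y & z & Hx & Hy & Hz & xy & yz & xz & H).
destruct (Hus b x y z) as [u [Hu E]]; auto.
exists u. split; [exact Hu|].
erewrite wrong_ext; [exact H|]. intros p Hp. simpl. rewrite E; auto.
Qed.

(** * Blocks of moves *)

Section Blocks.
Context {L : Type}.

(* Colourings of all points rather than cells only, so that no cell proofs are carried around. *)
Definition pconfig : Type := point L -> option color.

Lemma negbarK (x : Lbar L) : negbar (negbar x) = x.
Proof. destruct x as [[]| |]; reflexivity. Qed.

Lemma negdagK (x : Ldag L) : negdag (negdag x) = x.
Proof. destruct x; reflexivity. Qed.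

Definition psolved : pconfig := fun p => Some (solved_pt p).

Definition bt_pull (s : btwist L) (p : point L) : point L :=
  Nat.iter (inv_exp (bt_pow s)) (rot (bt_axis s) (bt_pos s)) p.

Definition pact (s : btwist L) (g : pconfig) : pconfig := fun p => g (bt_pull s p).

(** A turn preserves the coordinate along its axis, so the test made by [rot] has the same outcome
    in every iteration. *)
Lemma bt_pullE s p : bt_pull s p =
  if dec (crd (bt_axis s) p = bt_pos s)
  then Nat.iter (inv_exp (bt_pow s)) (turn (@negbar L) (bt_axis s)) p else p.
Proof.
destruct s as [i a k]; unfold bt_pull; simpl.
assert (R : forall q, rot i a q = if dec (crd i q = a) then turn (@negbar L) i q else q).
{ intros [[x y] z]; destruct i; simpl; destruct dec; reflexivity. }
generalize (inv_exp k) as m. induction m as [|m IH]; [destruct dec; reflexivity|].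
simpl. rewrite IH, R. destruct (dec (crd i p = a)) as [E|E].
- rewrite crd_turn. destruct dec; [reflexivity|contradiction].
- destruct dec; [contradiction|reflexivity].
Qed.

Definition oact (o : option (btwist L)) (g : pconfig) : pconfig :=
  match o with Some s => pact s g | None => g end.

Fixpoint bap (b : nat -> option (btwist L)) (g : pconfig) (j : nat) : pconfig :=
  match j with 0 => g | S j => oact (b j) (bap b g j) end.

Context (rk : Ldag L -> nat).

(** The positions at which twists are still allowed from row [n] on; faces always are. *)
Definition okpos (n : nat) (x : Lbar L) : Prop :=
  match x with Fin a => n <= rk a | _ => True end.

(* One stretch of [omega] moves, some of which may be skipped. *)
Definition is_step (n : nat) (b : nat -> option (btwist L)) (g h : pconfig) : Prop :=
  (forall j s, b j = Some s -> okpos n (bt_pos s)) /\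
  (forall p, exists N, forall j, N <= j -> bap b g j p = h p).

Definition step (n : nat) (g h : pconfig) : Prop := exists b, is_step n b g h.

Lemma step_refl n g : step n g g.
Proof.
exists (fun _ => None). split; [discriminate|].
intros p. exists 0. intros j _. induction j as [|j IH]; [reflexivity|exact IH].
Qed.

Fixpoint path (n : nat) (g : pconfig) (l : list pconfig) (h : pconfig) : Prop :=
  match l with
  | [] => g = h
  | x :: l => step n g x /\ path n x l h
  end.

Lemma path_app n g l h m k : path n g l h -> path n h m k -> path n g (l ++ m) k.
Proof.
revert g. induction l as [|x l IH]; intros g; simpl.
- intros ->. auto.
- intros [H1 H2] H3. split; [exact H1 | exact (IH _ H2 H3)].
Qed.

Definition isin {Tag} (D : Tag -> Lbar L -> Prop) (t : Tag) (x : Lbar L) : bool :=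
  if dec (D t x) then true else false.

Context (en : nat -> Lbar L) (code : Lbar L -> nat) (enK : forall x, en (code x) = x).

(** Parallel slices are disjoint and each is turned once, so every point is affected at most at one
    time and the block converges pointwise. *)
Lemma step_tw Tag (D : Tag -> Lbar L -> Prop) n g (l : @letter Tag) :
  (forall x, D (snd (fst l)) x -> okpos n x) ->
  step n g (fun p => g (tw (@negbar L) (isin D) l p)).
Proof.
destruct l as [[i t] k]; simpl. intros HD.
(* [en] may list a position repeatedly; it is turned only at the time given by its [code]. *)
pose (b := fun j => if dec (D t (en j) /\ code (en j) = j)
                    then Some (BTwist i (en j) k) else None).
exists b. split.
- intros j s. unfold b. destruct dec as [[H _]|]; [|discriminate].
  intros [= <-]. apply HD, H.
- intros p. exists (S (code (crd i p))). intros j Hj.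
  (* Before time [j] exactly the slices in the set with code below [j] have been turned. *)
  assert (A : forall j p, bap b g j p =
     g (if dec (D t (crd i p) /\ code (crd i p) < j)
        then Nat.iter (inv_exp k) (turn (@negbar L) i) p else p)).
  { clear p j Hj. induction j as [|j IH]; intros p.
    - destruct dec as [[_ H]|]; [lia|reflexivity].
    - simpl. unfold b at 1. destruct (dec (D t (en j) /\ code (en j) = j)) as [[H1 H2]|H].
      + unfold oact, pact. rewrite IH, bt_pullE; simpl.
        destruct (dec (crd i p = en j)) as [E|E].
        * rewrite crd_turn, E.
          destruct (dec (D t (en j) /\ code (en j) < j)) as [[_ F]|]; [lia|].
          destruct dec as [|F]; [reflexivity|]. exfalso; apply F; split; [exact H1|lia].
        * assert (code (crd i p) <> j) by (intros F; apply E; rewrite <- F; symmetry; apply enK).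
          destruct dec as [[F1 F2]|F]; destruct dec as [[G1 G2]|G]; try reflexivity; exfalso;
           [apply G | apply F]; split; auto; lia.
      + unfold oact. rewrite IH. f_equal.
        assert (D t (crd i p) -> code (crd i p) <> j)
          by (intros F1 F2; apply H; rewrite <- F2, enK; auto).
        destruct dec as [[F1 F2]|F]; destruct dec as [[G1 G2]|G]; try reflexivity; exfalso;
         [apply G | apply F]; split; auto; specialize (H0 ltac:(assumption)); lia. }
  rewrite A. unfold isin. destruct (dec (D t (crd i p))) as [E|E]; destruct dec as [F|F]; auto.
  + exfalso; apply F; split; [exact E|lia].
  + destruct F; contradiction.
Qed.

Lemma path_word Tag (D : Tag -> Lbar L -> Prop) n g (w : list (@letter Tag)) :
  (forall t x, D t x -> In t (map (fun l => snd (fst l)) w) -> okpos n x) ->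
  exists l, path n g l (fun p => g (pull (@negbar L) (isin D) w p)).
Proof.
revert g. induction w as [|c w IH]; intros g HD.
- exists []. reflexivity.
- destruct (IH (fun p => g (tw (@negbar L) (isin D) c p))) as [l Hl].
  { intros t x H1 H2. apply (HD t); [exact H1 | right; exact H2]. }
  exists ((fun p => g (tw (@negbar L) (isin D) c p)) :: l). split; [|exact Hl].
  apply step_tw. intros x Hx. apply (HD _ _ Hx). left; reflexivity.
Qed.

(** * Cells no longer touched by slice twists *)

Definition Safe (n : nat) (g : pconfig) : Prop :=
  forall p, cellP p -> (forall i, match crd i p with Fin a => rk a < n | _ => True end) ->
  g p = Some (solved_pt p).

Context (rk_neg : forall a, rk (negdag a) = rk a).

(** An allowed twist that moves a cell with all finite coordinates of rank below [n] is a face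
    twist; it takes the cell to another such cell of the same face. *)
Lemma Safe_pact n s g : okpos n (bt_pos s) -> Safe n g -> Safe n (pact s g).
Proof.
intros Hs Hg p Hp Hr. unfold pact. rewrite bt_pullE.
destruct s as [i x k]; simpl in *.
destruct dec as [E|]; [|apply Hg; assumption].
assert (Hx : x = PInf L \/ x = MInf L).
{ destruct x as [a| |]; auto. specialize (Hr i). rewrite E in Hr. simpl in Hs. lia. }
assert (A : forall m q, cellP q /\ (forall j, match crd j q with Fin a => rk a < n | _ => True end)
  /\ crd i q = x ->
  let q' := Nat.iter m (turn (@negbar L) i) q in
  (cellP q' /\ (forall j, match crd j q' with Fin a => rk a < n | _ => True end) /\ crd i q' = x)
  /\ solved_pt q' = solved_pt q).
{ induction m as [|m IH]; intros q Hq; [split; [exact Hq|reflexivity]|].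
  destruct (IH q Hq) as [(H1 & H2 & H3) H4]. simpl in *.
  rewrite <- H4. revert H1 H2 H3. clear -Hx rk_neg.
  generalize (Nat.iter m (turn (@negbar L) i) q). intros [[y1 y2] y3] H1 H2 H3.
  assert (G1 := H2 AX). assert (G2 := H2 AY). assert (G3 := H2 AZ). simpl in *.
  repeat split.
  - destruct i; simpl; rewrite ?ninf_neg; lia.
  - intros j; destruct i, j; simpl; auto;
    match goal with |- context [negbar ?y] => destruct y; simpl; rewrite ?rk_neg; auto end.
  - destruct i; exact H3.
  - destruct Hx; subst x; destruct i, y1, y2, y3; simpl in *; try discriminate; reflexivity. }
destruct (A (inv_exp k) p (conj Hp (conj Hr E))) as [(H1 & H2 & _) H4].
rewrite <- H4. apply Hg; assumption.
Qed.

Lemma Safe_bap n b g : (forall j s, b j = Some s -> okpos n (bt_pos s)) ->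
  Safe n g -> forall j, Safe n (bap b g j).
Proof.
intros Hb Hg j. induction j as [|j IH]; [exact Hg|]. simpl.
destruct (b j) eqn:E; [apply Safe_pact; [apply (Hb j), E|exact IH]|exact IH].
Qed.

Lemma Safe_step n g h : step n g h -> Safe n g -> Safe n h.
Proof.
intros [b [Hb Hc]] Hg p Hp Hr. destruct (Hc p) as [N HN].
rewrite <- (HN N (le_n _)). apply (Safe_bap _ Hb Hg N p Hp Hr).
Qed.

Lemma Safe_le n m g : n <= m -> Safe m g -> Safe n g.
Proof.
intros Hnm Hg p Hp Hr. apply Hg; [exact Hp|].
intros i. specialize (Hr i). destruct (crd i p); auto. lia.
Qed.

End Blocks.

(** * Clusters *)

Section Clusters.
Context {L : Type}.

Definition sgn (b : bool) (u : Ldag L) : Ldag L := if b then u else negdag u.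

Definition ev (u v : Ldag L) (s : ssym) : Lbar L :=
  match fst s with
  | SI => if snd s then PInf L else MInf L
  | SA => Fin (sgn (snd s) u)
  | SB => Fin (sgn (snd s) v)
  end.

(** For [u] and [v] both zero the 24 symbols name only the six centres, four times each; colouring
    symbols instead of cells gives this cluster the same form as the others. *)
Definition chi (g : pconfig) (u v : Ldag L) : coloring := fun p => g (map3 (ev u v) p).

Lemma ev_neg u v s : ev u v (sneg s) = negbar (ev u v s).
Proof. destruct s as [[] []]; simpl; rewrite ?negdagK; reflexivity. Qed.

Lemma cluster_cell u v p : In p orb24 -> cellP (map3 (ev u v) p).
Proof.
intros Hp.
assert (H : forall q : aptype, (let '(x, y, z) := q in
    match fst x, fst y, fst z with
    | SI, (SA | SB), (SA | SB) | (SA | SB), SI, (SA | SB) | (SA | SB), (SA | SB), SI => true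
    | _, _, _ => false end) = true -> cellP (map3 (ev u v) q)).
{ intros [[[[] []] [[] []]] [[] []]]; simpl; intros E; discriminate || reflexivity. }
apply H. revert p Hp. apply check24P. vm_compute. reflexivity.
Qed.

Lemma solved_cluster u v p : In p orb24 -> solved_pt (map3 (ev u v) p) = scol p.
Proof.
intros Hp. assert (H := cluster_cell u v Hp).
destruct p as [[[[] []] [[] []]] [[] []]]; simpl in *; reflexivity || discriminate.
Qed.

Lemma cell_cluster q : cellP q -> exists u v p, In p orb24 /\ q = map3 (ev u v) p /\
  (forall n (rk : Ldag L -> nat), (forall i, match crd i q with Fin a => rk a < n | _ => True end) ->
     rk u < n /\ rk v < n).
Proof.
destruct q as [[[a| |] [b| |]] [c| |]]; intros Hq; try discriminate Hq; clear Hq;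
 (* Orientation decides which finite coordinate plays the role of [u]: only half of the 48 signed
    arrangements lie in [orb24]. *)
 match goal with
 | |- exists u v p, In p orb24 /\ (PInf _, Fin ?x, Fin ?y) = _ /\ _ =>
    exists x, y, ((SI, true), (SA, true), (SB, true))
 | |- exists u v p, In p orb24 /\ (MInf _, Fin ?x, Fin ?y) = _ /\ _ =>
    exists y, x, ((SI, false), (SB, true), (SA, true))
 | |- exists u v p, In p orb24 /\ (Fin ?x, PInf _, Fin ?y) = _ /\ _ =>
    exists y, x, ((SB, true), (SI, true), (SA, true))
 | |- exists u v p, In p orb24 /\ (Fin ?x, MInf _, Fin ?y) = _ /\ _ =>
    exists x, y, ((SA, true), (SI, false), (SB, true))
 | |- exists u v p, In p orb24 /\ (Fin ?x, Fin ?y, PInf _) = _ /\ _ =>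
    exists x, y, ((SA, true), (SB, true), (SI, true))
 | |- exists u v p, In p orb24 /\ (Fin ?x, Fin ?y, MInf _) = _ /\ _ =>
    exists y, x, ((SB, true), (SA, true), (SI, false))
 end; (split; [apply memP; vm_compute; reflexivity|]; split; [reflexivity|];
  intros n rk H; assert (H1 := H AX); assert (H2 := H AY); assert (H3 := H AZ);
  simpl in *; auto).
Qed.

(* A quarter turn about the infinite coordinate shows that [(u, v)] and [(-v, u)] name
   the same cluster. *)
Lemma wrong_turn g u v : wrong (chi g u v) = 0 -> wrong (chi g (negdag v) u) = 0.
Proof.
rewrite !wrong0. intros H p Hp.
pose (ren := fun s : ssym => match fst s with
  | SI => s | SA => (SB, negb (snd s)) | SB => (SA, snd s) end).
assert (E : forall q, map3 (ev (negdag v) u) q = map3 (ev u v) (map3 ren q)).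
{ assert (E : forall s, ev (negdag v) u s = ev u v (ren s)).
  { intros [[] []]; unfold ev, ren; simpl; rewrite ?negdagK; reflexivity. }
  intros [[x y] z]. simpl. rewrite !E. reflexivity. }
unfold chi. rewrite E.
assert (C : (mem (map3 ren p) orb24 &&
   if color_eq_dec (scol (map3 ren p)) (scol p) then true else false) = true).
{ revert p Hp. apply check24P. vm_compute. reflexivity. }
apply andb_true_iff in C. destruct C as [C1 C2].
destruct color_eq_dec as [C3|]; [|discriminate]. rewrite <- C3.
apply H, memP, C1.
Qed.

(** * Words and commutators acting on clusters *)

Lemma pull_cluster Tag (D : Tag -> Lbar L -> Prop) w u v p :
  pull (@negbar L) (isin D) w (map3 (ev u v) p) =
  map3 (ev u v) (pull sneg (fun t s => isin D t (ev u v s)) w p).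
Proof. apply pull_map3; [apply ev_neg | reflexivity]. Qed.

Lemma balanced_pull Tag (D : Tag -> Lbar L -> Prop) g w u v :
  balanced (chi g u v) -> balanced (chi (fun p => g (pull (@negbar L) (isin D) w p)) u v).
Proof.
intros H. unfold balanced.
rewrite (map_ext (chi (fun p => g (pull (@negbar L) (isin D) w p)) u v)
   (fun p => chi g u v (pull sneg (fun t s => isin D t (ev u v s)) w p))).
- rewrite <- (map_map (pull sneg (fun t s => isin D t (ev u v s)) w) (chi g u v)).
  apply Permutation_trans with (2 := H). apply Permutation_map, pull_perm.
- intros p. unfold chi. rewrite pull_cluster. reflexivity.
Qed.

(** The tag [SB] collects all slices from [S], which may be infinite; a letter with this tag is
    realized by a block of omega moves. *)
Definition Dset (a : Ldag L) (S : Ldag L -> Prop) (t : ssym) (x : Lbar L) : Prop :=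
  match fst t with
  | SI => x = if snd t then PInf L else MInf L
  | SA => x = Fin (sgn (snd t) a)
  | SB => exists b, S b /\ x = Fin (sgn (snd t) b)
  end.

Definition truth (P : Prop) : bool := if dec P then true else false.

Lemma truthP P : truth P = true <-> P.
Proof. unfold truth; destruct dec; split; congruence. Qed.

Lemma truth_iff P b : (P <-> b = true) -> truth P = b.
Proof. unfold truth; destruct dec, b; intuition. Qed.

Definition bits_of (a : Ldag L) (S : Ldag L -> Prop) (u v : Ldag L) : bits :=
  Bits (fun b => truth (sgn b u = a)) (fun b => truth (S (sgn b u)))
       (fun b => truth (sgn b v = a)) (fun b => truth (S (sgn b v))).

Lemma sgn_eq t s (u a : Ldag L) : Fin (sgn t u) = Fin (sgn s a) <-> sgn (eqb s t) u = a.
Proof.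
destruct t, s; simpl; split; intros H; try congruence.
- injection H as ->. apply negdagK.
- rewrite <- H, negdagK. reflexivity.
- injection H as H. rewrite <- (negdagK u), H. apply negdagK.
Qed.

(** With these bits the finite checks on symbols apply to the actual cluster of [u], [v]. *)
Lemma mt_bits_of a S u v t s : mt (bits_of a S u v) t s = isin (Dset a S) t (ev u v s).
Proof.
symmetry. apply truth_iff. destruct t as [[] t], s as [[] s]; unfold Dset, ev, mt; simpl.
- destruct t, s; simpl; split; congruence || discriminate.
- destruct t; split; discriminate.
- destruct t; split; discriminate.
- destruct s; split; discriminate.
- rewrite truthP. apply sgn_eq.
- rewrite truthP. apply sgn_eq.
- split; [intros (b & _ & H); destruct s; discriminate H | discriminate].
- rewrite truthP. split.
  + intros (b & Hb & H). apply sgn_eq in H. rewrite H. exact Hb.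
  + intros H. eexists. split; [exact H|]. apply sgn_eq. reflexivity.
- rewrite truthP. split.
  + intros (b & Hb & H). apply sgn_eq in H. rewrite H. exact Hb.
  + intros H. eexists. split; [exact H|]. apply sgn_eq. reflexivity.
Qed.

Lemma chi_pull g a S w u v p :
  chi (fun q => g (pull (@negbar L) (isin (Dset a S)) w q)) u v p =
  chi g u v (apull (bits_of a S u v) w p).
Proof.
unfold chi, apull. f_equal.
apply pull_map3; [apply ev_neg | intros; symmetry; apply mt_bits_of].
Qed.

(** * Clearing a family of clusters by greedy 3-cycles *)

Definition kind (a b : Ldag L) : bits :=
  if dec (a = negdag a) then kind_cross else if dec (b = negdag a) then kind_diag else kind_generic.

Lemma kind_kinds a b : In (kind a b) kinds.
Proof. unfold kind; destruct dec; [|destruct dec]; simpl; auto. Qed.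

(** These conditions force the pattern of each cluster (a, b) with b in S to be one of [kinds]. *)
Record target (a : Ldag L) (S : Ldag L -> Prop) : Prop := {
  target_row : ~ S a;
  target_neg : forall b, S b -> ~ S (negdag b);
  target_diag : forall b, S b -> S (negdag a) -> b = negdag a }.

Lemma kind_bits a S b w p : target a S -> S b ->
  apull (bits_of a S a b) w p = apull (kind a b) w p.
Proof.
intros [H1 H2 H3] Hb. rewrite bits_eta. simpl.
assert (H4 := H3 b Hb). assert (H5 := H2 b Hb).
assert (b <> a) by congruence.
rewrite (proj2 (truthP (a = a))), (proj2 (truthP (S b))), (truth_iff (b := false) (P := S a)),
 (truth_iff (b := false) (P := b = a)), (truth_iff (b := false) (P := S (negdag b)))
 by intuition discriminate.
unfold kind. destruct (dec (a = negdag a)) as [E|E].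
- rewrite (proj2 (truthP (negdag a = a))) by auto.
  rewrite (truth_iff (b := false) (P := S (negdag a))) by (rewrite <- E; intuition discriminate).
  rewrite (truth_iff (b := false) (P := negdag b = a)).
  + reflexivity.
  + split; [|discriminate]. intros F. exfalso. rewrite <- F, negdagK in E. congruence.
- rewrite (truth_iff (b := false) (P := negdag a = a)) by intuition (discriminate || congruence).
  destruct (dec (b = negdag a)) as [F|F].
  + rewrite (proj2 (truthP (S (negdag a)))) by congruence.
    rewrite (proj2 (truthP (negdag b = a))) by (rewrite F; apply negdagK). reflexivity.
  + rewrite (truth_iff (b := false) (P := S (negdag a))) by intuition discriminate.
    rewrite (truth_iff (b := false) (P := negdag b = a)); [reflexivity|].
    split; [|discriminate]. intros G. exfalso. apply F. rewrite <- G, negdagK. reflexivity.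
Qed.

Lemma conj_word_rest a (S : Ldag L -> Prop) u v : ~ S a ->
  ~ (u = a /\ S v) -> ~ (negdag v = a /\ S u) -> ~ (negdag u = a /\ S (negdag v)) ->
  ~ (v = a /\ S (negdag u)) ->
  forall x p, In p orb24 -> apull (bits_of a S u v) (conj_word x) p = p.
Proof.
intros H0 H1 H2 H3 H4 x p Hp.
assert (T : forall P Q : Prop, ~ (P /\ Q) -> truth P && truth Q = false).
{ intros P Q H. unfold truth. destruct (dec P), (dec Q); tauto || reflexivity. }
apply conj_word_off; [| |exact Hp]; unfold off_target, disjoint_bits; simpl.
- rewrite !T; auto.
- rewrite !T; auto; intros [<- H]; contradiction.
Qed.

Definition greedy (a : Ldag L) (S0 : Ldag L -> Prop) (g : pconfig) (x : list (@letter ssym))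
  (b : Ldag L) : Prop :=
  S0 b /\ wrong (fun p => chi g a b (apull (kind a b) (conj_word x) p)) < wrong (chi g a b).

Definition greedy_step a S0 g x : pconfig :=
  fun p => g (pull (@negbar L) (isin (Dset a (greedy a S0 g x))) (conj_word x) p).

Lemma greedy_target a S0 g x : target a S0 -> target a (greedy a S0 g x).
Proof.
intros [H1 H2 H3]. split; unfold greedy.
- intros [H _]. exact (H1 H).
- intros b [H _] [H' _]. exact (H2 b H H').
- intros b [H _] [H' _]. exact (H3 b H H').
Qed.

Lemma greedy_in a S0 g x b : target a S0 -> greedy a S0 g x b ->
  wrong (chi (greedy_step a S0 g x) a b) < wrong (chi g a b).
Proof.
intros Ht Hb. erewrite wrong_ext; [exact (proj2 Hb)|].
intros p _. unfold greedy_step. rewrite chi_pull, kind_bits; auto using greedy_target.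
Qed.

Lemma greedy_out a S0 g x b p : target a S0 -> S0 b -> ~ greedy a S0 g x b -> In p orb24 ->
  chi (greedy_step a S0 g x) a b p = chi g a b p.
Proof.
intros Ht Hb Hn Hp. unfold greedy_step. rewrite chi_pull.
assert (Ht' := greedy_target g x Ht). destruct Ht as [T1 T2 T3]. destruct Ht' as [U1 U2 U3].
rewrite conj_word_rest; auto.
- intros [_ H]. exact (Hn H).
- intros [_ H]. exact (U1 H).
- intros [_ [H _]]. exact (T2 b Hb H).
- intros [-> _]. contradiction.
Qed.

(** A solved cluster is solved under each of its four names, and zero errors cannot decrease; so it
    is never selected and the word acts trivially on it. *)
Lemma greedy_solved a S0 g x u v : target a S0 -> wrong (chi g u v) = 0 ->
  wrong (chi (greedy_step a S0 g x) u v) = 0.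
Proof.
intros Ht Hw. assert (Ht' := greedy_target g x Ht).
assert (T1 := target_row Ht').
assert (N : forall b, wrong (chi g a b) = 0 -> ~ greedy a S0 g x b).
{ intros b Hb [_ H]. lia. }
rewrite <- Hw. apply wrong_ext. intros p Hp. unfold greedy_step.
rewrite chi_pull, conj_word_rest; auto.
- intros [-> H]. exact (N v Hw H).
- intros [E H]. apply wrong_turn in Hw. rewrite E in Hw. exact (N u Hw H).
- intros [E H]. apply wrong_turn, wrong_turn in Hw. rewrite E in Hw. exact (N _ Hw H).
- intros [E H]. apply wrong_turn, wrong_turn, wrong_turn in Hw.
  rewrite negdagK, E in Hw. exact (N _ Hw H).
Qed.

Definition good_step (g h : pconfig) : Prop :=
  (forall u v, balanced (chi g u v) -> balanced (chi h u v)) /\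
  (forall u v, wrong (chi g u v) = 0 -> wrong (chi h u v) = 0).

Lemma good_refl g : good_step g g.
Proof. split; auto. Qed.

Lemma good_trans g h k : good_step g h -> good_step h k -> good_step g k.
Proof.
intros [H1 H2] [H3 H4]; split; intros u v H; [apply H3, H1, H | apply H4, H2, H].
Qed.

Lemma greedy_good a S0 g x : target a S0 -> good_step g (greedy_step a S0 g x).
Proof.
intros Ht. split.
- intros u v. apply balanced_pull.
- intros u v. apply greedy_solved, Ht.
Qed.

Context (rk : Ldag L -> nat) (rk_neg : forall a, rk (negdag a) = rk a).
Context (en : nat -> Lbar L) (code : Lbar L -> nat) (enK : forall x, en (code x) = x).

Lemma greedy_path n a S0 g x : n <= rk a -> (forall b, S0 b -> n <= rk b) ->
  exists l, path rk n g l (greedy_step a S0 g x).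
Proof.
intros Ha HS. apply (path_word rk en code enK). intros t y Hy _.
assert (R : forall s u, rk (sgn s u) = rk u) by (intros [] u; simpl; auto).
destruct t as [[] t]; unfold Dset in Hy; simpl in Hy.
- subst y. destruct t; exact I.
- subst y. simpl. rewrite R. exact Ha.
- destruct Hy as (b & [Hb _] & ->). simpl. rewrite R. apply HS, Hb.
Qed.

(** A cluster (a, b) stays unchanged until some word of the list gains on it, so a word that
    improves it at the outset still does so when its turn comes. *)
Lemma greedy_pass n a S0 us g : n <= rk a -> (forall b, S0 b -> n <= rk b) -> target a S0 ->
  exists l h, path rk n g l h /\ good_step g h /\
    forall b, S0 b -> wrong (chi h a b) <= wrong (chi g a b) /\
      ((exists x, In x us /\
         wrong (fun p => chi g a b (apull (kind a b) (conj_word x) p)) < wrong (chi g a b)) ->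
       wrong (chi h a b) < wrong (chi g a b)).
Proof.
intros Ha HS Ht. revert g. induction us as [|x us IH]; intros g.
- exists [], g. split; [reflexivity|]. split; [apply good_refl|].
  intros b Hb. split; [lia|]. intros (x & [] & _).
- destruct (greedy_path S0 g x Ha HS) as [l1 P1].
  destruct (IH (greedy_step a S0 g x)) as (l2 & h & P2 & G2 & W2).
  exists (l1 ++ l2), h. split; [eapply path_app; [exact P1|exact P2]|].
  split; [exact (good_trans (greedy_good g x Ht) G2)|].
  intros b Hb. destruct (W2 b Hb) as [W3 W4].
  destruct (dec (greedy a S0 g x b)) as [Hin|Hout].
  + assert (W := greedy_in Ht Hin). split; [lia|]. intros _. lia.
  + assert (E := fun p => greedy_out (p := p) Ht Hb Hout).
    rewrite (wrong_ext _ _ E) in W3, W4. split; [exact W3|].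
    intros (y & [<-|Hy] & Hlt); [exfalso; apply Hout; split; assumption|].
    apply W4. exists y. split; [exact Hy|].
    erewrite wrong_ext; [exact Hlt|]. intros p Hp. simpl. apply E, apull_orb24, Hp.
Qed.

(** The number of passes has a bound common to all [b], so finitely many words solve infinitely many
    clusters. *)
Lemma stage n a S0 g : n <= rk a -> (forall b, S0 b -> n <= rk b) -> target a S0 ->
  (forall u v, balanced (chi g u v)) ->
  exists l h, path rk n g l h /\ good_step g h /\ forall b, S0 b -> wrong (chi h a b) = 0.
Proof.
intros Ha HS Ht Hg. destruct improving_words as [us Hus].
assert (M : forall m g, (forall u v, balanced (chi g u v)) -> (forall b, S0 b -> wrong (chi g a b) <= m) ->
  exists l h, path rk n g l h /\ good_step g h /\ forall b, S0 b -> wrong (chi h a b) = 0).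
{ clear g Hg. induction m as [|m IH]; intros g Hg Hm.
  - exists [], g. split; [reflexivity|]. split; [apply good_refl|].
    intros b Hb. specialize (Hm b Hb). lia.
  - destruct (greedy_pass us g Ha HS Ht) as (l1 & h1 & P1 & G1 & W1).
    destruct (IH h1) as (l2 & h & P2 & G2 & W2).
    + intros u v. apply G1, Hg.
    + intros b Hb. destruct (W1 b Hb) as [W2 W3]. specialize (Hm b Hb).
      destruct (Nat.eq_dec (wrong (chi g a b)) 0) as [E|E]; [lia|].
      assert (wrong (chi h1 a b) < wrong (chi g a b)); [|lia].
      apply W3, Hus; auto using kind_kinds.
    + exists (l1 ++ l2), h. split; [eapply path_app; [exact P1|exact P2]|].
      split; [exact (good_trans G1 G2)|exact W2]. }
(* A cluster has 24 cells, and each pass lowers a nonzero number of errors. *)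
apply (M 24 g Hg). intros b _. unfold wrong.
apply Nat.le_trans with (1 := filter_length_le _ _). reflexivity.
Qed.

End Clusters.

(** * Rows *)

Section Rows.
Context {L : Type}.
Context (rk : Ldag L -> nat) (rk_neg : forall a, rk (negdag a) = rk a) (rk_zero : rk (Zero L) = 0).
Context (rk_inj : forall a b, rk a = rk b -> a = b \/ a = negdag b).
Context (en : nat -> Lbar L) (code : Lbar L -> nat) (enK : forall x, en (code x) = x).

(** Holds between rows, where one coordinate of rank below [n] is enough. [Safe] concerns cells with
    both coordinates of rank below [n] and thus persists inside a commutator as well. The centres
    have their own clause, as no target contains [a] itself. *)
Definition Inv (n : nat) (g : pconfig) : Prop :=
  (forall u v, balanced (chi g u v)) /\
  wrong (chi g (Zero L) (Zero L)) = 0 /\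
  forall u v, rk u < n \/ rk v < n -> wrong (chi g u v) = 0.

Lemma Inv_good n g h : good_step g h -> Inv n g -> Inv n h.
Proof.
intros [G1 G2] (H1 & H2 & H3). split; [|split].
- intros u v. apply G1, H1.
- apply G2, H2.
- intros u v H. apply G2, H3, H.
Qed.

Lemma Inv_Safe n g : Inv n g -> Safe rk n g.
Proof.
intros (_ & _ & H) p Hp Hr.
destruct (cell_cluster p Hp) as (u & v & q & Hq & -> & R).
destruct (R n rk Hr) as [R1 _].
rewrite solved_cluster by exact Hq.
exact (proj1 (wrong0 _) (H u v (or_introl R1)) q Hq).
Qed.

Lemma row n g : Inv n g -> exists l h, path rk n g l h /\ Inv (S n) h.
Proof.
intros Hg.
destruct (classic (exists a, rk a = n)) as [[a Ha]|Hn].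
2: { exists [], g. split; [reflexivity|]. destruct Hg as (H1 & H2 & H3).
  split; [exact H1|split; [exact H2|]]. intros u v H. apply H3.
  assert (rk u <> n) by (intros E; apply Hn; exists u; exact E).
  assert (rk v <> n) by (intros E; apply Hn; exists v; exact E). lia. }
(* A target cannot contain both b and -b, and can contain -a only alone, so the row is split into
   three. *)
pose (S1 := fun b => n < rk b /\ exists r, b = Pos r).
pose (S2 := fun b => n < rk b /\ exists r, b = Neg r).
pose (S3 := fun b => b = negdag a /\ b <> a).
assert (T1 : target a S1).
{ split.
  - intros [H _]. lia.
  - intros b [_ [r ->]] [_ [r' E]]. discriminate E.
  - intros b _ [H _]. rewrite rk_neg in H. lia. }
assert (T2 : target a S2).
{ split.
  - intros [H _]. lia.
  - intros b [_ [r ->]] [_ [r' E]]. discriminate E.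
  - intros b _ [H _]. rewrite rk_neg in H. lia. }
assert (T3 : target a S3).
{ split.
  - intros [_ H]. apply H; reflexivity.
  - intros b [-> _] [_ H]. apply H, negdagK.
  - intros b [E _] _. exact E. }
assert (Hna : n <= rk a) by lia.
destruct (@stage _ rk rk_neg en code enK n a S1 g) as (l1 & h1 & P1 & G1 & W1); auto.
{ intros b [H _]. lia. }
{ apply Hg. }
assert (I1 := Inv_good G1 Hg).
destruct (@stage _ rk rk_neg en code enK n a S2 h1) as (l2 & h2 & P2 & G2 & W2); auto.
{ intros b [H _]. lia. }
{ apply I1. }
assert (I2 := Inv_good G2 I1).
destruct (@stage _ rk rk_neg en code enK n a S3 h2) as (l3 & h3 & P3 & G3 & W3); auto.
{ intros b [-> _]. rewrite rk_neg. exact Hna. }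
{ apply I2. }
assert (I3 := Inv_good G3 I2).
exists (l1 ++ l2 ++ l3), h3. split.
{ eapply path_app; [exact P1|]. eapply path_app; [exact P2|exact P3]. }
(* If [w] has the rank of [a], it is a or -a; the pairs (a, a) and (a, -a) name the same cluster,
   which for a = 0 is that of the centres. *)
assert (K : forall w, n <= rk w -> wrong (chi h3 a w) = 0).
{ intros w Hw.
  destruct (Nat.eq_dec (rk w) n) as [E|E].
  - assert (D : a = Zero L \/ a <> negdag a) by (destruct a; auto; right; discriminate).
    destruct D as [D|D].
    + assert (w = Zero L) as ->.
      { destruct (@rk_inj w a) as [F|F]; [congruence| |]; rewrite F, D; reflexivity. }
      rewrite D. exact (proj1 (proj2 I3)).
    + assert (W : wrong (chi h3 a (negdag a)) = 0) by (apply W3; split; congruence).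
      destruct (@rk_inj w a) as [->| ->]; [congruence| |exact W].
      apply wrong_turn in W. rewrite negdagK in W. exact W.
  - destruct w as [r| |r].
    + apply G3, W2. split; [lia|exists r; reflexivity].
    + lia.
    + apply G3, G2, W1. split; [lia|exists r; reflexivity]. }
destruct I3 as (J1 & J2 & J3). split; [exact J1|split; [exact J2|]].
intros u v Huv.
destruct (classic (rk u < n \/ rk v < n)) as [H|H]; [exact (J3 u v H)|].
(* Quarter turns rename the cluster so that [a] comes first. *)
destruct (Nat.eq_dec (rk u) n) as [E|E].
- destruct (@rk_inj u a) as [->| ->]; [congruence|apply K; lia|].
  assert (W := K (negdag v)). rewrite rk_neg in W. specialize (W ltac:(lia)).
  apply wrong_turn, wrong_turn in W. rewrite negdagK in W. exact W.
- assert (rk v = n) by lia.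
  destruct (@rk_inj v a) as [->| ->]; [congruence| |].
  + assert (W := K (negdag u)). rewrite rk_neg in W. specialize (W ltac:(lia)).
    apply wrong_turn in W. rewrite negdagK in W. exact W.
  + assert (W := K u ltac:(lia)).
    apply wrong_turn, wrong_turn, wrong_turn in W. rewrite negdagK in W. exact W.
Qed.

(* Flattening of the finite lists of steps of the successive rows: a state consists of the
   row, the configuration and the configurations still to be visited in this row. *)
Definition state : Type := (nat * pconfig (L := L) * list (pconfig (L := L)))%type.

Definition good_state (st : state) : Prop :=
  let '(n, g, l) := st in Safe rk n g /\ exists h, path rk n g l h /\ Inv (S n) h.

Definition next (st : state) : state :=
  match st with
  | (n, g, x :: l) => (n, x, l)
  | (n, g, []) =>
    (S n, g, epsilon (inhabits []) (fun l => exists h, path rk (S n) g l h /\ Inv (S (S n)) h))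
  end.

(** An exhausted list is followed by an empty step that opens the next row, so the sequence of steps
    never ends. *)
Lemma next_good st : good_state st ->
  good_state (next st) /\ step rk (fst (fst st)) (snd (fst st)) (snd (fst (next st))).
Proof.
destruct st as [[n g] [|x l]]; simpl.
- intros (Hs & h & <- & Hi). split; [|apply step_refl].
  split; [exact (Inv_Safe Hi)|].
  apply (epsilon_spec (inhabits []) (fun l => exists h, path rk (S n) g l h /\ Inv (S (S n)) h)).
  apply row, Hi.
- intros (Hs & h & [H1 H2] & Hi). split; [|exact H1].
  split; [exact (Safe_step rk_neg H1 Hs) | exists h; auto].
Qed.

(** The first row is supplied from outside, because its list also contains the word that solves the
    centres. *)
Lemma rows g : Safe rk 0 g -> (exists l h, path rk 0 g l h /\ Inv 1 h) ->
  exists (N : nat -> nat) (G : nat -> pconfig (L := L)), G 0 = g /\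
    (forall k, step rk (N k) (G k) (G (S k)) /\ Safe rk (N k) (G k)) /\
    forall m, exists K, forall k, K <= k -> m <= N k.
Proof.
intros Hs [l Hl]. pose (st := fun k => Nat.iter k next (0, g, l)).
exists (fun k => fst (fst (st k))), (fun k => snd (fst (st k))).
assert (Hgood : forall k, good_state (st k)).
{ induction k as [|k IH]; [split; assumption|]. apply (next_good _ IH). }
split; [reflexivity|]. split.
- intros k. split; [apply (next_good _ (Hgood k))|].
  assert (H := Hgood k). destruct (st k) as [[n x] r]. apply H.
- assert (mono : forall k, fst (fst (st k)) <= fst (fst (st (S k)))).
  { intros k. change (st (S k)) with (next (st k)). destruct (st k) as [[n x] [|y r]]; simpl; lia. }
  assert (mono' : forall K k, K <= k -> fst (fst (st K)) <= fst (fst (st k))).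
  { intros K k. induction 1 as [|k _ IH]; [lia|]. specialize (mono k). lia. }
  (* The [q] pending configurations take [q] steps, and opening the next row takes one more. *)
  assert (grows : forall q k, length (snd (st k)) = q ->
            fst (fst (st (k + S q))) = S (fst (fst (st k)))).
  { induction q as [|q IH]; intros k Hk.
    - replace (k + 1) with (S k) by lia. change (st (S k)) with (next (st k)).
      destruct (st k) as [[n x] [|y r]]; simpl in *; [reflexivity|discriminate].
    - replace (k + S (S q)) with (S k + S q) by lia.
      assert (E : length (snd (st (S k))) = q /\ fst (fst (st (S k))) = fst (fst (st k))).
      { change (st (S k)) with (next (st k)).
        destruct (st k) as [[n x] [|y r]]; simpl in *; [discriminate|].
        split; [congruence|reflexivity]. }
      rewrite IH; [rewrite (proj2 E); reflexivity | apply E]. }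
  induction m as [|m [K HK]]; [exists 0; intros; lia|].
  exists (K + S (length (snd (st K)))). intros k Hk.
  apply mono' in Hk. rewrite (grows _ K eq_refl) in Hk. specialize (HK K (le_n _)). lia.
Qed.

End Rows.

(** * Skipping the empty moves of a run of length [omega^2] *)

Definition plt (p q : option (nat * nat)) : Prop :=
  match p, q with
  | Some a, Some b => lex_lt a b
  | Some _, None => True
  | None, _ => False
  end.

Lemma lex_wf : well_founded lex_lt.
Proof.
intros [k j]. revert j. induction k as [k IHk] using lt_wf_ind.
intros j. induction j as [j IHj] using lt_wf_ind.
constructor. intros [k' j'] [H|[H1 H2]]; simpl in *; [apply IHk, H | subst; apply IHj, H2].
Qed.

Lemma plt_wf : well_founded plt.
Proof.
assert (H : forall a, Acc plt (Some a)).
{ intros a. induction a as [a IH] using (well_founded_ind lex_wf).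
  constructor. intros [b|] Hb; [apply IH, Hb | destruct Hb]. }
intros [a|]; [apply H|]. constructor. intros [b|] Hb; [apply H | destruct Hb].
Qed.

Lemma lex_trans a b c : lex_lt a b -> lex_lt b c -> lex_lt a c.
Proof. unfold lex_lt; lia. Qed.

Lemma lex_total a b : lex_lt a b \/ a = b \/ lex_lt b a.
Proof.
destruct a as [a1 a2], b as [b1 b2]; unfold lex_lt; simpl.
destruct (Nat.lt_trichotomy a1 b1) as [|[->|]], (Nat.lt_trichotomy a2 b2) as [|[->|]]; auto 6.
Qed.

Lemma plt_trans p q r : plt p q -> plt q r -> plt p r.
Proof.
destruct p, q, r; simpl; try tauto. apply lex_trans.
Qed.

Lemma plt_total p q : plt p q \/ p = q \/ plt q p.
Proof.
destruct p as [a|], q as [b|]; simpl; auto.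
destruct (lex_total a b) as [|[->|]]; auto.
Qed.

Lemma plt_irrefl p : ~ plt p p.
Proof. destruct p; simpl; unfold lex_lt; lia. Qed.

Lemma plt_succ k j p : plt (Some (k, j)) p <-> p = Some (k, S j) \/ plt (Some (k, S j)) p.
Proof.
destruct p as [[k' j']|]; simpl; [|intuition].
unfold lex_lt; simpl. split.
- intros H. destruct (Nat.eq_dec k k') as [<-|]; [|lia].
  destruct (Nat.eq_dec j' (S j)) as [->|]; [auto|lia].
- intros [[= -> ->]|H]; lia.
Qed.

Section Compress.
Context {L : Type} (s : nat * nat -> option (btwist L)) (F : option (nat * nat) -> config L).
Hypothesis F_succ : forall k j, F (Some (k, S j)) =
  match s (k, j) with Some t => act t (F (Some (k, j))) | None => F (Some (k, j)) end.
Hypothesis F_omega : forall k c, exists J, forall j, J <= j -> F (Some (k, j)) c = F (Some (S k, 0)) c.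
Hypothesis F_omega2 : forall c, exists K, forall k j, K <= k -> F (Some (k, j)) c = F None c.

(** By transfinite induction: a successor of an idle position repeats its value, and a limit takes
    the value of late positions, which can be chosen after [x]. *)
Lemma F_idle y x : x = y \/ plt x y ->
  (forall w, ~ plt (Some w) x -> plt (Some w) y -> s w = None) -> F y = F x.
Proof.
induction y as [y IH] using (well_founded_ind plt_wf). intros [->|Hxy] Hs; [reflexivity|].
assert (IH' : forall z, plt z y -> x = z \/ plt x z -> F z = F x).
{ intros z Hz Hx. apply IH; auto. intros w H1 H2. apply Hs; [exact H1|].
  exact (plt_trans _ _ _ H2 Hz). }
destruct x as [[a b]|]; [|destruct Hxy].
destruct y as [[k [|j]]|].
- destruct k as [|k]; simpl in Hxy; unfold lex_lt in Hxy; simpl in Hxy; [lia|].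
  apply functional_extensionality. intros c. destruct (F_omega k c) as [J HJ].
  (* The summand [S b] keeps the position after [x] even if [k] equals [a]. *)
  rewrite <- (HJ (J + S b)) by lia.
  rewrite IH'; [reflexivity| |]; simpl; unfold lex_lt; simpl; [lia|right; lia].
- assert (B : Some (a, b) = Some (k, j) \/ plt (Some (a, b)) (Some (k, j))).
  { destruct (plt_total (Some (a, b)) (Some (k, j))) as [|[|H]]; auto.
    exfalso. apply plt_succ in H. simpl in H, Hxy. unfold lex_lt in H, Hxy; simpl in H, Hxy.
    destruct H as [[= -> ->]|]; lia. }
  assert (B' : plt (Some (k, j)) (Some (k, S j))) by (simpl; unfold lex_lt; simpl; lia).
  rewrite F_succ, (Hs (k, j)); [apply IH'; assumption| |exact B'].
  intros H. destruct B as [B|B]; [rewrite B in H; exact (plt_irrefl _ H)|].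
  exact (plt_irrefl _ (plt_trans _ _ _ H B)).
- apply functional_extensionality. intros c. destruct (F_omega2 c) as [K HK].
  rewrite <- (HK (K + S a) 0) by lia.
  rewrite IH'; [reflexivity| |]; simpl; [exact I|].
  right. unfold lex_lt; simpl. lia.
Qed.

Definition moves : Type := {w : nat * nat | s w <> None}.
Definition moves_lt (a b : moves) : Prop := lex_lt (proj1_sig a) (proj1_sig b).

Lemma moves_total a b : moves_lt a b \/ a = b \/ moves_lt b a.
Proof.
destruct a as [a Ha], b as [b Hb]; unfold moves_lt; simpl.
destruct (lex_total a b) as [|[E|]]; auto. right; left. subst b.
f_equal. apply proof_irrelevance.
Qed.

Definition moves_order : wellorder :=
  @WellOrder moves moves_lt
    (fun a b c => @lex_trans (proj1_sig a) (proj1_sig b) (proj1_sig c))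
    moves_total (wf_inverse_image _ _ _ _ lex_wf).

Definition move (a : moves) : btwist L :=
  match s (proj1_sig a) with Some t => t | None => BTwist AX (PInf L) P1 end.

Definition place (p : option moves) : option (nat * nat) := option_map (@proj1_sig _ _) p.

Lemma place_lt (p q : option moves) : pos_lt (W := moves_order) p q <-> plt (place p) (place q).
Proof. destruct p, q; simpl; tauto. Qed.

(* The moves below a limit position [p] of the compressed run are cofinal below a limit
   position [p'] of the original one, and the moves between [p'] and [p] are empty. *)
Lemma limit_place (p : option moves) :
  (exists q, pos_lt (W := moves_order) q p) ->
  (forall q, pos_lt (W := moves_order) q p ->
     exists r, pos_lt (W := moves_order) q r /\ pos_lt (W := moves_order) r p) ->
  forall c, exists w0, pos_lt (W := moves_order) w0 p /\
    forall r, w0 = r \/ pos_lt (W := moves_order) w0 r -> pos_lt (W := moves_order) r p ->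
      F (place r) c = F (place p) c.
Proof.
intros [q1 Hq1] Hlim c.
pose (U := fun q => forall w : option moves, plt (place w) (place p) -> plt (place w) q).
(* [p'] is the least strict upper bound of the moves below [p]. *)
assert (exists p', U p' /\ forall q, plt q p' -> ~ U q) as (p' & HU & Hmin).
{ apply NNPP. intros Hno.
  assert (A : forall q, ~ U q).
  { intros q. induction q as [q IH] using (well_founded_ind plt_wf).
    intros Hq. apply Hno. exists q. auto. }
  apply (A (place p)). intros w Hw. exact Hw. }
assert (cof : forall q, plt q p' -> exists w : option moves,
          plt (place w) (place p) /\ ~ plt (place w) q).
{ intros q Hq. apply NNPP. intros Hno. apply (Hmin q Hq). intros w Hw.
  apply NNPP. intros Hn. apply Hno. exists w; auto. }
assert (Fp : F (place p) = F p').
{ apply F_idle.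
  - destruct (plt_total p' (place p)) as [|[|H]]; auto.
    exfalso. apply (Hmin _ H). intros w Hw; exact Hw.
  - intros w H1 H2. apply NNPP. intros Hw. apply H1.
    exact (HU (Some (exist _ w Hw)) H2). }
assert (exists q0, plt q0 p' /\ forall r, ~ plt r q0 -> plt r p' -> F r c = F p' c)
  as (q0 & Hq0 & Hconst).
{ destruct p' as [[k [|j]]|].
  - destruct k as [|k].
    + exfalso. apply place_lt in Hq1. apply HU in Hq1.
      destruct (place q1) as [[x y]|]; simpl in Hq1; unfold lex_lt in Hq1; simpl in Hq1; lia.
    + destruct (F_omega k c) as [J HJ]. exists (Some (k, J)).
      split; [simpl; unfold lex_lt; simpl; lia|].
      intros [[x y]|] H1 H2; [|destruct H2]. simpl in H1, H2. unfold lex_lt in H1, H2; simpl in *.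
      assert (x = k) as -> by lia. apply HJ. lia.
  (* Were [p'] a successor, a move at its predecessor would be the last one below [p]. *)
  - exfalso. destruct (cof (Some (k, j))) as (w & H1 & H2).
    { simpl; unfold lex_lt; simpl; lia. }
    assert (H3 := HU w H1).
    apply place_lt in H1. destruct (Hlim w H1) as (r & R1 & R2).
    apply place_lt in R1. apply place_lt in R2. assert (R3 := HU r R2).
    destruct (place w) as [[x y]|]; [|destruct H3].
    destruct (place r) as [[x' y']|]; [|destruct R3].
    simpl in H2, H3, R1, R3. unfold lex_lt in H2, H3, R1, R3; simpl in H2, H3, R1, R3. lia.
  - destruct (F_omega2 c) as [K HK]. exists (Some (K, 0)). split; [exact I|].
    intros [[x y]|] H1 H2; [|destruct H2]. apply HK.
    simpl in H1; unfold lex_lt in H1; simpl in H1. lia. }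
destruct (cof q0 Hq0) as (w0 & H1 & H2).
exists w0. split; [apply place_lt, H1|].
intros r Hr Hrp. rewrite Fp. apply Hconst; [|apply HU, place_lt, Hrp].
intros H3. apply H2. destruct Hr as [->|Hr]; [exact H3|].
apply place_lt in Hr. exact (plt_trans _ _ _ Hr H3).
Qed.

Lemma compress : exists (W : wellorder) (t : W -> btwist L),
  le_omega2 W /\ terminal W t (F (Some (0, 0))) (F None).
Proof.
exists moves_order, move. split; [exists (@proj1_sig _ _); intros a b H; exact H|].
exists (fun p => F (place p)). split; [|reflexivity].
intros p. split; [|split].
- intros Hp. apply F_idle.
  + destruct (plt_total (Some (0, 0)) (place p)) as [|[|H]]; auto.
    exfalso. destruct (place p) as [[x y]|]; simpl in H; unfold lex_lt in H; simpl in H; lia.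
  + intros w _ H. apply NNPP. intros Hw. apply (Hp (Some (exist _ w Hw))).
    apply place_lt. exact H.
- intros a Hap Hn. destruct a as [[k j] Ha]. apply place_lt in Hap. simpl in Hap.
  change (F (place p) = act (move (exist _ (k, j) Ha)) (F (Some (k, j)))).
  transitivity (F (Some (k, S j))).
  (* All positions after this move and before [p] are idle. *)
  + apply F_idle.
    * apply plt_succ in Hap. destruct Hap as [->|]; auto.
    * intros w H1 H2. apply NNPP. intros Hw. apply (Hn (Some (exist _ w Hw))).
      split; apply place_lt; [|exact H2]. apply plt_succ. simpl.
      destruct (plt_total (Some w) (Some (k, S j))) as [H|[H|H]]; [contradiction|auto|auto].
  + rewrite F_succ. unfold move; simpl. clear Hn.
    destruct (s (k, j)); [reflexivity|destruct (Ha eq_refl)].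
- intros Hex Hlim c.
  destruct (limit_place p Hex Hlim c) as (w0 & Hw0 & Hc). split.
  + intros q Hq Hqc. rewrite <- (Hc w0) by auto.
    destruct (plt_total (place q) (place w0)) as [H|[H|H]].
    * apply Hqc; [apply place_lt, H|exact Hw0].
    * rewrite H. reflexivity.
    * rewrite (Hc w0), (Hc q); auto. right. apply place_lt, H.
  + intros Hno. exfalso. destruct (Hno w0 Hw0) as (r & R1 & R2 & R3).
    apply R3. rewrite (Hc r), (Hc w0); auto.
Qed.

End Compress.

(** * Clusters of accessible configurations *)

Section Accessible.
Context {L : Type}.

Definition lift (g : config L) : pconfig (L := L) :=
  fun p => match dec (cellP p) with left h => g (exist _ p h) | right _ => None end.

Definition restrict (g : pconfig) : config L := fun c => g (proj1_sig c).

Lemma lift_cell g (c : cell L) : lift g (proj1_sig c) = g c.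
Proof.
unfold lift. destruct c as [p h]; simpl. destruct dec as [h'|n]; [|contradiction].
do 2 f_equal. apply proof_irrelevance.
Qed.

Lemma bt_inv_pull s (c : cell L) : proj1_sig (bt_inv s c) = bt_pull s (proj1_sig c).
Proof.
unfold bt_inv, bt_pull. generalize (inv_exp (bt_pow s)) as m.
induction m as [|m IH]; [reflexivity|]. simpl. rewrite IH. reflexivity.
Qed.

Lemma lift_act s g p : cellP p -> lift (act s g) p = lift g (bt_pull s p).
Proof.
intros h. change p with (proj1_sig (exist (fun q : point L => cellP q) p h)).
rewrite lift_cell, <- bt_inv_pull, lift_cell. reflexivity.
Qed.

Lemma restrict_act s g : act s (restrict g) = restrict (pact s g).
Proof.
apply functional_extensionality. intros c. unfold act, restrict, pact.
rewrite bt_inv_pull. reflexivity.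
Qed.

Definition at_pos (x y : Lbar L) : Prop := y = x.

Definition letter_of (s : btwist L) : @letter (Lbar L) := (bt_axis s, bt_pos s, bt_pow s).

Lemma tw_letter_of s p : tw (@negbar L) (isin at_pos) (letter_of s) p = bt_pull s p.
Proof.
rewrite bt_pullE. unfold letter_of, tw, isin, at_pos.
destruct (dec (crd (bt_axis s) p = bt_pos s)); reflexivity.
Qed.

Definition reachable (u v : Ldag L) (g : pconfig) : Prop :=
  exists w, forall q, In q orb24 ->
    g (map3 (ev u v) q) = psolved (pull (@negbar L) (isin at_pos) w (map3 (ev u v) q)).

Definition spoiled (u v : Ldag L) (g : pconfig) : Prop :=
  exists q, In q orb24 /\ g (map3 (ev u v) q) = None.

Lemma bt_pull_cluster (s : btwist L) u v q : In q orb24 ->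
  exists q', In q' orb24 /\ bt_pull s (map3 (ev u v) q) = map3 (ev u v) q'.
Proof.
intros Hq. rewrite <- tw_letter_of.
change (tw (@negbar L) (isin at_pos) (letter_of s) (map3 (ev u v) q))
  with (pull (@negbar L) (isin at_pos) [letter_of s] (map3 (ev u v) q)).
rewrite pull_cluster. eexists. split; [|reflexivity]. apply pull_orb24, Hq.
Qed.

Lemma reachable_act s u v g : reachable u v (lift g) -> reachable u v (lift (act s g)).
Proof.
intros [w Hw]. exists (w ++ [letter_of s]). intros q Hq.
rewrite lift_act by (apply cluster_cell, Hq).
rewrite pull_app.
change (pull (@negbar L) (isin at_pos) [letter_of s] (map3 (ev u v) q))
  with (tw (@negbar L) (isin at_pos) (letter_of s) (map3 (ev u v) q)).
rewrite tw_letter_of.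
destruct (bt_pull_cluster s u v Hq) as (q' & Hq' & ->). apply Hw, Hq'.
Qed.

(** A twist permutes the cluster, so it moves a NaC within it but cannot remove it; the inverse
    twist [t] locates its new place. *)
Lemma spoiled_act s u v g : spoiled u v (lift g) -> spoiled u v (lift (act s g)).
Proof.
intros (q & Hq & E).
pose (t := BTwist (bt_axis s) (bt_pos s) (match bt_pow s with P1 => P3 | P2 => P2 | P3 => P1 end)).
destruct (bt_pull_cluster t u v Hq) as (q' & Hq' & E').
exists q'. split; [exact Hq'|].
rewrite lift_act by (apply cluster_cell, Hq'). rewrite <- E', <- E. f_equal.
rewrite <- !tw_letter_of. change (letter_of t) with (linv (letter_of s)).
apply tw_linv, negbarK.
Qed.

Lemma pos_lt_wf (W : wellorder) : well_founded (@pos_lt W).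
Proof.
assert (H : forall a : W, Acc (@pos_lt W) (Some a)).
{ intros a. induction a as [a IH] using (well_founded_ind (wo_wf W)).
  constructor. intros [b|] Hb; [apply IH, Hb | destruct Hb]. }
intros [a|]; [apply H|]. constructor. intros [b|] Hb; [apply H | destruct Hb].
Qed.

Lemma pos_lt_trans (W : wellorder) (p q r : option W) : pos_lt p q -> pos_lt q r -> pos_lt p r.
Proof. destruct p, q, r; simpl; try tauto. apply wo_trans. Qed.

Lemma pos_lt_total (W : wellorder) (p q : option W) : pos_lt p q \/ p = q \/ pos_lt q p.
Proof.
destruct p as [a|], q as [b|]; simpl; auto.
destruct (wo_total W a b) as [|[->|]]; auto.
Qed.

(* A limit stage that leaves no NaC on the finite cluster agrees there with an earlier stage. *)
Lemma run_cluster (W : wellorder) (s : W -> btwist L) F (u v : Ldag L) :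
  is_run W s (@f_solved L) F -> forall p, reachable u v (lift (F p)) \/ spoiled u v (lift (F p)).
Proof.
intros HF p. induction p as [p IH] using (well_founded_ind (@pos_lt_wf W)).
destruct (HF p) as (H0 & Hs & Hl).
destruct (classic (exists q, pos_lt q p)) as [Hex|Hno].
2: { left. rewrite H0 by (intros q Hq; apply Hno; exists q; exact Hq).
  exists []. intros q Hq. simpl.
  change (map3 (ev u v) q) with (proj1_sig (exist (fun r : point L => cellP r) _ (cluster_cell u v Hq))) at 1.
  rewrite lift_cell. reflexivity. }
destruct (classic (exists q, pos_lt q p /\ forall r, ~ (pos_lt q r /\ pos_lt r p)))
  as [([a|] & Ha & Hi)|Hlim].
- rewrite (Hs a Ha Hi).
  destruct (IH (Some a) Ha) as [H|H]; [left; apply reachable_act, H | right; apply spoiled_act, H].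
- destruct Ha.
- destruct (classic (spoiled u v (lift (F p)))) as [|Hsp]; [right; assumption|left].
  assert (Hlim' : forall q, pos_lt q p -> exists r, pos_lt q r /\ pos_lt r p).
  { intros q Hq. apply NNPP. intros Hn. apply Hlim. exists q. split; [exact Hq|].
    intros r Hr. apply Hn. exists r; exact Hr. }
  assert (Hc : forall c, F p c <> None -> exists q, pos_lt q p /\
            forall r, q = r \/ pos_lt q r -> pos_lt r p -> F r c = F p c).
  { intros c Hnone. destruct (Hl Hex Hlim' c) as [Hl1 Hl2].
    assert (exists q, pos_lt q p /\ forall r, pos_lt q r -> pos_lt r p -> F r c = F q c)
      as (q & Hq & Hqc).
    { apply NNPP. intros Hn. apply Hnone, Hl2. intros q Hq. apply NNPP. intros Hn'.
      apply Hn. exists q. split; [exact Hq|]. intros r H1 H2. apply NNPP. intros H3.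
      apply Hn'. exists r. auto. }
    exists q. split; [exact Hq|]. rewrite (Hl1 q Hq Hqc).
    intros r [<-|Hr] Hrp; [reflexivity|apply Hqc; assumption]. }
  (* Finitely many cells have a common stage from which on all of them show their limit colours. *)
  assert (Hu : forall l, incl l orb24 -> exists q, pos_lt q p /\
            forall r, q = r \/ pos_lt q r -> pos_lt r p -> forall x, In x l ->
              lift (F r) (map3 (ev u v) x) = lift (F p) (map3 (ev u v) x)).
  { induction l as [|x l IHl]; intros Hincl.
    - destruct Hex as [q Hq]. exists q. split; [exact Hq|]. intros r _ _ x [].
    - destruct IHl as (q1 & Q1 & R1); [intros y Hy; apply Hincl; right; exact Hy|].
      assert (Hx := Hincl x (or_introl eq_refl)).
      pose (c := exist (fun r : point L => cellP r) (map3 (ev u v) x) (cluster_cell u v Hx)).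
      assert (E : forall g, lift g (map3 (ev u v) x) = g c) by (intros g; apply (lift_cell g c)).
      destruct (Hc c) as (q2 & Q2 & R2).
      { intros Hn. apply Hsp. exists x. split; [exact Hx|]. rewrite E. exact Hn. }
      assert (exists q, pos_lt q p /\ (q1 = q \/ pos_lt q1 q) /\ (q2 = q \/ pos_lt q2 q))
        as (q & Q & B1 & B2).
      { destruct (pos_lt_total W q1 q2) as [H|[->|H]]; [exists q2|exists q2|exists q1]; auto. }
      exists q. split; [exact Q|].
      intros r Hr Hrp y [<-|Hy].
      + rewrite !E. apply R2; [|exact Hrp].
        destruct Hr as [<-|Hr]; [exact B2|]. right.
        destruct B2 as [->|B2]; [exact Hr|exact (pos_lt_trans W _ _ _ B2 Hr)].
      + apply R1; [|exact Hrp|exact Hy].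
        destruct Hr as [<-|Hr]; [exact B1|]. right.
        destruct B1 as [->|B1]; [exact Hr|exact (pos_lt_trans W _ _ _ B1 Hr)]. }
  destruct (Hu orb24 (incl_refl _)) as (q & Hq & Hqe).
  assert (E := Hqe q (or_introl eq_refl) Hq).
  destruct (IH q Hq) as [[w Hw]|(x & Hx & Hn)].
  + exists w. intros x Hx. rewrite <- E by exact Hx. apply Hw, Hx.
  + exfalso. apply Hsp. exists x. split; [exact Hx|]. rewrite <- E; assumption.
Qed.

Lemma accessible_reachable (f : config L) u v :
  legal f -> accessible (@f_solved L) f -> reachable u v (lift f).
Proof.
intros Hf (W & s & F & HF & <-).
destruct (run_cluster u v HF None) as [H|(q & Hq & Hn)]; [exact H|exfalso].
apply (Hf (exist _ _ (cluster_cell u v Hq))). rewrite <- Hn.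
symmetry. apply (lift_cell (F None) (exist _ _ (cluster_cell u v Hq))).
Qed.

Lemma balanced_ext (c d : coloring) :
  (forall p, In p orb24 -> c p = d p) -> balanced c -> balanced d.
Proof. intros H. unfold balanced. rewrite (map_ext_in _ _ _ H). auto. Qed.

Lemma reachable_balanced u v g : reachable u v g -> balanced (chi g u v).
Proof.
intros [w Hw].
apply balanced_ext with (chi (fun p => psolved (pull (@negbar L) (isin at_pos) w p)) u v).
- intros q Hq. symmetry. apply Hw, Hq.
- apply balanced_pull. unfold balanced. rewrite (map_ext_in _ (fun p => Some (scol p))).
  + apply Permutation_refl.
  + intros q Hq. unfold chi, psolved. rewrite solved_cluster by exact Hq. reflexivity.
Qed.

End Accessible.

(** * Enumerating and ranking the positions *)

Section Enumeration.
Context {L : Type} (e : nat -> L) (e_surj : forall r : L, exists n, e n = r).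

Definition enum (n : nat) : Lbar L :=
  match n with
  | 0 => PInf L
  | 1 => MInf L
  | 2 => Fin (Zero L)
  | S (S (S m)) => Fin (if Nat.even m then Pos (e (Nat.div2 m)) else Neg (e (Nat.div2 m)))
  end.

Lemma enum3 m :
  enum (3 + m) = Fin (if Nat.even m then Pos (e (Nat.div2 m)) else Neg (e (Nat.div2 m))).
Proof. reflexivity. Qed.

Lemma enum_surj x : exists n, enum n = x.
Proof.
destruct x as [[r| |r]| |].
- destruct (e_surj r) as [n <-]. exists (3 + S (2 * n)).
  rewrite enum3.
  rewrite Nat.even_succ, Nat.odd_mul, Nat.div2_succ_double. reflexivity.
- exists 2. reflexivity.
- destruct (e_surj r) as [n <-]. exists (3 + 2 * n).
  rewrite enum3.
  rewrite Nat.even_mul, Nat.div2_double. reflexivity.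
- exists 0. reflexivity.
- exists 1. reflexivity.
Qed.

Definition index (r : L) : nat := proj1_sig (constructive_indefinite_description _ (e_surj r)).

Lemma indexK r : e (index r) = r.
Proof. exact (proj2_sig (constructive_indefinite_description _ (e_surj r))). Qed.

(** A rank stands for an absolute value, with 0 reserved for the central slice. *)
Definition rank (a : Ldag L) : nat :=
  match a with Zero _ => 0 | Pos r | Neg r => S (index r) end.

Lemma rank_inj a b : rank a = rank b -> a = b \/ a = negdag b.
Proof.
assert (H : forall r r', S (index r) = S (index r') -> r = r').
{ intros r r' [= E]. rewrite <- (indexK r), E. apply indexK. }
destruct a, b; simpl; intros E; try discriminate; auto; apply H in E; subst; auto.
Qed.

End Enumeration.

(** * Assembling the solution of length at most omega^2 *)

Theorem theorem5p7 (L : Type) (e : nat -> L)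
  (e_inj : forall m n, e m = e n -> m = n)
  (e_surj : forall r : L, exists n, e n = r)
  (f : config L) :
  legal f -> accessible (@f_solved L) f ->
  exists (W : wellorder) (s : W -> btwist L),
    le_omega2 W /\ @terminal L W s f (@f_solved L).
Proof.
intros Hlegal Hacc.
pose (rk := rank e e_surj).
assert (rk_neg : forall a, rk (negdag a) = rk a) by (intros []; reflexivity).
assert (rk_zero : rk (Zero L) = 0) by reflexivity.
assert (rk_inj : forall a b, rk a = rk b -> a = b \/ a = negdag b) by apply rank_inj.
pose (code := fun x => proj1_sig (constructive_indefinite_description _ (enum_surj e e_surj x))).
assert (enK : forall x, enum e (code x) = x)
  by (intros x; exact (proj2_sig (constructive_indefinite_description _ (enum_surj e e_surj x)))).
assert (Hr : forall u v, reachable u v (lift f))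
  by (intros u v; apply accessible_reachable; assumption).
destruct (Hr (Zero L) (Zero L)) as [w Hw].
(* The inverse of the word for the centres solves them and permutes every other cluster within
   itself, so colour counts persist. *)
pose (g := fun p => lift f (pull (@negbar L) (isin (@at_pos L)) (winv w) p)).
assert (Hg : Inv rk 0 g).
{ split; [|split].
  - intros u v. apply balanced_pull, reachable_balanced, Hr.
  - apply wrong0. intros q Hq. unfold chi, g.
    assert (H := pull_cluster (@at_pos L) (winv w) (Zero L) (Zero L) q).
    rewrite H, Hw by (apply pull_orb24, Hq).
    rewrite <- H, pull_winv by apply negbarK.
    unfold psolved. rewrite solved_cluster by exact Hq. reflexivity.
  - intros u v [H|H]; lia. }
destruct (path_word rk (enum e) code enK (@at_pos L) 0 (lift f) (winv w)) as [l1 P1].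
{ intros t x _ _. destruct x; simpl; auto. lia. }
destruct (row rk_neg rk_zero rk_inj (enum e) code enK Hg) as (l2 & h & P2 & Ih).
destruct (rows rk_neg rk_zero rk_inj (enum e) code enK (g := lift f)) as (N & G & G0 & Gstep & Gunb).
(* No rank is below 0, so [Safe] holds vacuously at the start. *)
{ intros p Hp H. exfalso. destruct (cell_cluster p Hp) as (u & v & q & _ & _ & R).
  destruct (R 0 rk H). lia. }
{ exists (l1 ++ l2), h. split; [|exact Ih]. eapply path_app; [exact P1|exact P2]. }
pose (b := fun k => proj1_sig (constructive_indefinite_description _ (proj1 (Gstep k)))).
assert (Hb : forall k, is_step rk (N k) (b k) (G k) (G (S k)))
  by (intros k; exact (proj2_sig (constructive_indefinite_description _ (proj1 (Gstep k))))).
pose (F := fun p : option (nat * nat) =>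
  match p with Some (k, j) => restrict (bap (b k) (G k) j) | None => @f_solved L end).
assert (F0 : F (Some (0, 0)) = f).
{ apply functional_extensionality. intros c. simpl. unfold restrict. rewrite G0. apply lift_cell. }
rewrite <- F0.
apply (compress (fun w => b (fst w) (snd w)) F).
- intros k j. simpl. destruct (b k j) as [t|]; [symmetry; apply restrict_act | reflexivity].
- intros k c. apply (proj2 (Hb k)).
- intros c. destruct (cell_cluster (proj1_sig c) (proj2_sig c)) as (u & v & q & Hq & E & _).
  assert (exists m, forall i, match crd i (proj1_sig c) with Fin a => rk a < m | _ => True end)
    as [m Hm].
  (* A bound above both ranks: once the rows below it are done, the cell keeps its solved colour. *)
  { exists (S (rk u + rk v)). rewrite E. intros i. rewrite crd_map3.
    destruct (crd i q) as [[] []]; simpl; auto; rewrite ?rk_neg; lia. }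
  destruct (Gunb m) as [K HK]. exists K. intros k j Hk.
  assert (S1 := Safe_bap rk_neg (b k) (proj1 (Hb k)) (proj2 (Gstep k)) j).
  exact (Safe_le (HK k Hk) S1 (proj1_sig c) (proj2_sig c) Hm).
Qed.
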